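(* Let $m\in\mathbb{N}\setminus\{0\}$, $n\ge 2$ and $\tau>0$. There exist a map $F\in C^\infty(\mathbb{R}^n;\mathcal{M}_{n\times n}(\mathbb{R}))$ and a linear map $G:\mathbb{R}^n\to\mathbb{R}^n$ such that $F$ is diagonal (i.e. $F(u)$ is a diagonal matrix for every $u \in \mathbb{R}^n$), $F(0)$ has distinct positive eigenvalues, $$\hat\rho_\infty\big(G'(0)\big)<1+\tau,\qquad \hat\rho_0\big(G'(0)\big)=\hat\rho_2\big(G'(0)\big)<1,$$ and the equilibrium solution $u \equiv 0$ is not exponentially stable with respect to the $C^m$-norm for the system $$\begin{cases} u_t+F(u)u_x=0 & \text{for every } (t,x)\in[0,+\infty)\times[0,1],\\ u(t,0)=G\big(u(t,1)\big) & \text{for every } t\in[0,+\infty).\end{cases}$$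
   Context: $\mathcal{M}_{n\times n}(\mathbb{R})$ is the set of real $n\times n$ matrices, and $G'(0)\in \mathcal{M}_{n\times n}(\mathbb{R})$ is the Jacobian matrix of $G$ at $0$. The unknown is $u:[0,+\infty)\times[0,1]\to\mathbb{R}^n$. **Matrix quantities.** For $x\in\mathbb{R}^n$, $\|x\|_p:=(\sum_{i=1}^n|x_i|^p)^{1/p}$ if $1\le p<\infty$ and $\|x\|_\infty:=\max_i|x_i|$. For $M\in\mathcal{M}_{n\times n}(\mathbb{R})$, $\|M\|_p:=\max_{\|x\|_p=1}\|Mx\|_p$. Let $\mathcal{D}_{n,+}$ be the set of $n\times n$ real diagonal matrices whose diagonal entries are strictly positive. For $p\in[1,\infty]$, $$\hat\rho_p(M):=\inf\{\|\Delta M\Delta^{-1}\|_p:\ \Delta\in\mathcal{D}_{n,+}\},$$ and $$\hat\rho_0(M):=\max\{\rho\big(\mathrm{diag}(e^{i\theta_1},\dots,e^{i\theta_n})M\big):\ \theta_1,\dots,\theta_n\in\mathbb{R}\},$$ where $\rho$ denotes the spectral radius. **Compatibility conditions of order $m$.** For a map $\mathcal{H}:C^0([0,1];\mathbb{R}^n)\to C^0([0,1];\mathbb{R}^n)$ of class $C^m$, define by induction on $k$ maps $D^k\mathcal{H}:C^k([0,1];\mathbb{R}^n)\to C^0([0,1];\mathbb{R}^n)$ by $(D^0\mathcal{H})(u):=\mathcal{H}(u)$ and, for $k\in\{1,\dots,m\}$ and $u \in C^k([0,1];\mathbb{R}^n)$, $$(D^k\mathcal{H})(u):=\big((D^{k-1}\mathcal{H})'(u)\big)\big(F(u)u_x\big),$$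 i.e. the derivative of $D^{k-1}\mathcal{H}$ at $u$ applied to $F(u)u_x$ (for instance $(D^1\mathcal{H})(u)=\mathcal{H}'(u)F(u)u_x$). Let $\mathcal{I}$ be the identity map of $C^0([0,1];\mathbb{R}^n)$ and let $\mathcal{G}:C^0([0,1];\mathbb{R}^n)\to C^0([0,1];\mathbb{R}^n)$ be $(\mathcal{G}(v))(x):=G(v(x))$. A function $u^0\in C^m([0,1];\mathbb{R}^n)$ satisfies the compatibility conditions of order $m$ if $$((D^k\mathcal{I})(u^0))(0)=((D^k\mathcal{G})(u^0))(1)\quad\text{for every }k\in\{0,1,\dots,m\}.$$ **Exponential stability with respect to the $C^m$-norm.** The equilibrium solution $u\equiv0$ is exponentially stable for the system with respect to the $C^m$-norm if there exist $\varepsilon>0$, $\nu>0$ and $C>0$ such that, for every $u^0\in C^m([0,1];\mathbb{R}^n)$ satisfying the compatibility conditions of order $m$ and such that $\|u^0\|_{C^m([0,1];\mathbb{R}^n)}\le\varepsilon$, there exists one and only one solution $u\in C^m([0,+\infty)\times[0,1];\mathbb{R}^n)$ of the system satisfying the initial condition $u(0,\cdot)=u^0$, and this solution satisfies $$\|u(t,\cdot)\|_{C^m([0,1];\mathbb{R}^n)}\le Ce^{-\nu t}\|u^0\|_{C^m([0,1];\mathbb{R}^n)}\quad\text{for all }t>0.$$ *)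

(* Defs.v *)
From HB Require Import structures.
From mathcomp Require Import all_boot all_order all_algebra.
From mathcomp Require Import all_classical all_reals all_analysis.
From mathcomp Require Import complex.

Set Implicit Arguments.
Unset Strict Implicit.
Unset Printing Implicit Defensive.

Import Order.TTheory GRing.Theory Num.Theory.
Import numFieldNormedType.Exports.

Local Open Scope classical_set_scope.
Local Open Scope ring_scope.

Section MatrixQuantities.
Context {R : realType} {n : nat}.
Implicit Types (p : \bar R) (M : 'M[R]_n).

(* The value at p = -oo is irrelevant: only p in [1, +oo] is meaningful. *)
Definition lpnorm p (x : 'cV[R]_n) : R :=
  match p with
  | q%:E => (\sum_(i < n) `|x i 0| `^ q) `^ q^-1
  | +oo%E => \big[Num.max/0]_(i < n) `|x i 0|
  | -oo%E => 0
  end.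

Definition opnorm p M : R :=
  sup [set lpnorm p (M *m x) | x in [set x | lpnorm p x = 1]].

Definition hat_rho p M : R :=
  inf [set opnorm p (diag_mx d *m M *m invmx (diag_mx d))
      | d in [set d : 'rV[R]_n | forall i, 0 < d 0 i]].

Definition spectral_radius (A : 'M[R[i]]_n) : R :=
  sup [set ComplexField.Normc.normc a | a in [set a | eigenvalue A a]].

Definition phase_mx (theta : 'I_n -> R) : 'M[R[i]]_n :=
  diag_mx (\row_i (cos (theta i) +i* sin (theta i))%C).

(* The supremum is a maximum, by compactness of the torus of phases and
   continuity of the spectral radius. *)
Definition hat_rho0 M : R :=
  sup [set spectral_radius (phase_mx theta *m map_mx (real_complex R) M)
      | theta in [set: 'I_n -> R]].

Definition jacobian_mx (G : 'cV[R]_n -> 'cV[R]_n) (x : 'cV[R]_n) : 'M[R]_n :=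
  \matrix_(i, j) ('D_(delta_mx j 0) G x) i 0.

(* n distinct eigenvalues of an n x n matrix exhaust its spectrum. *)
Definition distinct_positive_eigenvalues M : Prop :=
  exists l : 'I_n -> R,
    injective l /\ forall i, 0 < l i /\ eigenvalue M (l i).

End MatrixQuantities.

Section Smooth.
Context {R : realType} {V W : normedModType R}.

(* For a finite dimensional V, the directional derivatives are the linear
   combinations of the partial ones, so this is the usual class C^k. *)
Fixpoint class_C (k : nat) (f : V -> W) : Prop :=
  match k with
  | 0 => continuous f
  | k'.+1 => (forall x, differentiable f x) /\
             (forall v, class_C k' (fun x => 'D_v f x))
  end.

Definition smooth (f : V -> W) : Prop := forall k, class_C k f.

End Smooth.

Section DeriveIn.
Context {R : realType} {V : normedModType R}.
Implicit Types (A : set R) (f : R -> V).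

(* Derivative relative to A; one-sided at the end points of an interval A. *)
Definition derivable_in A f (x : R) : Prop :=
  cvg (h^-1 *: (f (h + x) - f x) @[h --> within [set h | A (h + x)] 0^']).

Definition derive_in A f (x : R) : V :=
  lim (h^-1 *: (f (h + x) - f x) @[h --> within [set h | A (h + x)] 0^']).

Definition derive_in_n A (j : nat) f : R -> V := iter j (derive_in A) f.

Definition class_C_in A (k : nat) f : Prop :=
  (forall j, (j <= k)%N -> {within A, continuous (derive_in_n A j f)}) /\
  (forall j, (j < k)%N -> forall x, A x -> derivable_in A (derive_in_n A j f) x).

Definition I01 : set R := `[0, 1]%classic.
Definition Rplus : set R := `[0, +oo[%classic.

Definition sup_norm01 f : R := sup [set `|f x| | x in I01].

Definition Cnorm (k : nat) f : R :=
  \big[Num.max/0]_(j < k.+1) sup_norm01 (derive_in_n I01 j f).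

(* Partial derivatives on [0, +oo) x [0, 1], one-sided on the boundary. *)
Definition dt (u : R -> R -> V) : R -> R -> V :=
  fun t x => derive_in Rplus (u ^~ x) t.
Definition dx (u : R -> R -> V) : R -> R -> V :=
  fun t x => derive_in I01 (u t) x.

Fixpoint class_C_strip (k : nat) (u : R -> R -> V) : Prop :=
  {within Rplus `*` I01, continuous (fun q : R * R => u q.1 q.2)} /\
  match k with
  | 0 => True
  | k'.+1 =>
      [/\ forall t x, Rplus t -> I01 x ->
            derivable_in Rplus (u ^~ x) t /\ derivable_in I01 (u t) x,
          class_C_strip k' (dt u) & class_C_strip k' (dx u)]
  end.

End DeriveIn.
Arguments I01 {R}.
Arguments Rplus {R}.

Section DeriveInTheory.
Context {R : realType} {V : normedModType R}.
Implicit Types (f g : R -> V).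

Lemma within_I01_proper (x : R) : I01 x ->
  ProperFilter (within [set h | I01 (h + x)] (0 : R)^').
Proof.
move=> Ix; split; last exact: within_filter.
rewrite /within /= => -[e /= e0 He].
have : x \in `[0, 1]%R by [].
rewrite in_itv /= => /andP[x0 x1].
pose d := Num.min (e / 2) (1 / 2).
have d0 : 0 < d by rewrite lt_min !divr_gt0.
have de : d < e by rewrite gt_min ltr_pdivrMr// ltr_pMr// ltr1n.
have d2 : d <= 1/2 by rewrite ge_min lexx orbT.
have [xh|xh] := leP x (1/2).
  apply: (He d) => /=.
  - by rewrite sub0r normrN gtr0_norm.
  - by rewrite gt_eqF.
  - rewrite /I01 /= in_itv /= addr_ge0 ?(ltW d0)//=.
    by rewrite [leRHS](splitr 1) lerD.
apply: (He (- d)) => /=.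
- by rewrite sub0r opprK gtr0_norm.
- by rewrite oppr_eq0 gt_eqF.
- rewrite /I01 /= in_itv /= addrC subr_ge0 (le_trans d2 (ltW xh))/=.
  by rewrite lerBlDr (le_trans x1)// lerDl ltW.
Qed.

Lemma near_within_I01 (x : R) (f g : R -> V) : I01 x ->
  (forall y, I01 y -> f y = g y) ->
  \forall h \near within [set h | I01 (h + x)] (0 : R)^',
    h^-1 *: (f (h + x) - f x) = h^-1 *: (g (h + x) - g x).
Proof.
move=> Ix fg; apply: (@filterS _ _ _ [set h | I01 (h + x)]).
  by move=> h Ih; rewrite /= !fg.
exact: withinT.
Qed.

Lemma derive_in_eq f g : (forall y, I01 y -> f y = g y) ->
  forall x, I01 x -> derive_in I01 f x = derive_in I01 g x.
Proof.
move=> fg x Ix; rewrite /derive_in; congr (lim _); apply/seteqP.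
have FF := within_I01_proper Ix.
have gf y : I01 y -> g y = f y by move=> /fg.
split; apply: near_eq_cvg; first exact: near_within_I01 Ix fg.
exact: near_within_I01 Ix gf.
Qed.

Lemma derivable_in_eq f g : (forall y, I01 y -> f y = g y) ->
  forall x, I01 x -> derivable_in I01 f x -> derivable_in I01 g x.
Proof.
move=> fg x Ix /cvg_ex[l fl]; apply/cvg_ex; exists l; apply: cvg_trans fl.
have FF := within_I01_proper Ix.
by apply: near_eq_cvg; exact: near_within_I01 Ix fg.
Qed.

Lemma derive_in_lin (a : R) f g (x : R) : I01 x ->
  derivable_in I01 f x -> derivable_in I01 g x ->
  derivable_in I01 (a *: f + g) x /\
  derive_in I01 (a *: f + g) x = a *: derive_in I01 f x + derive_in I01 g x.
Proof.
move=> Ix df dg; have FF := within_I01_proper Ix.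
have E : (fun h : R => h^-1 *: ((a *: f + g) (h + x) - (a *: f + g) x)) =
  (fun h => a *: (h^-1 *: (f (h + x) - f x)) + h^-1 *: (g (h + x) - g x)).
  apply/funext => h /=; rewrite !scalerA mulrC -scalerA -scalerDr; congr (_ *: _).
  by rewrite scalerBr opprD addrACA.
have C : (h^-1 *: ((a *: f + g) (h + x) - (a *: f + g) x))
   @[h --> within [set h | I01 (h + x)] (0 : R)^'] -->
   a *: derive_in I01 f x + derive_in I01 g x.
  by rewrite E; apply: cvgD; [apply: cvgZl_tmp|].
split; first by apply/cvg_ex; eexists; exact: C.
exact: cvg_lim C.
Qed.

Lemma derive_in_n_lin k (a : R) f g :
  class_C_in I01 k f -> class_C_in I01 k g ->
  forall j, (j <= k)%N -> forall x, I01 x ->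
  derive_in_n I01 j (a *: f + g) x =
  a *: derive_in_n I01 j f x + derive_in_n I01 j g x.
Proof.
move=> [_ df] [_ dg]; elim=> [|j IH] jk x Ix //=.
rewrite (@derive_in_eq _ (a *: derive_in_n I01 j f + derive_in_n I01 j g))//.
  by have [] := derive_in_lin a Ix (df _ jk _ Ix) (dg _ jk _ Ix).
by move=> y Iy; rewrite IH// ltnW.
Qed.

Lemma class_C_in_lin k (a : R) f g :
  class_C_in I01 k f -> class_C_in I01 k g -> class_C_in I01 k (a *: f + g).
Proof.
move=> Cf Cg; have L := derive_in_n_lin a Cf Cg.
case: (Cf) => cf df; case: (Cg) => cg dg; split => j jk.
  have /subspace_eq_continuous : {in (I01 : set R),
      (a *: derive_in_n I01 j f + derive_in_n I01 j g) =1
      derive_in_n I01 j (a *: f + g)}.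
    by move=> x /set_mem Ix; rewrite L.
  have /subspace_continuousP cfj := cf _ jk.
  have /subspace_continuousP cgj := cg _ jk.
  apply; apply/subspace_continuousP => x Ix.
  apply: cvgD; last exact: cgj.
  by apply: cvgZl_tmp; exact: cfj.
move=> x Ix.
apply: (@derivable_in_eq (a *: derive_in_n I01 j f + derive_in_n I01 j g)) => //.
  by move=> y Iy; rewrite L// ltnW.
by have [] := derive_in_lin a Ix (df _ jk _ Ix) (dg _ jk _ Ix).
Qed.

Lemma derive_in_n0 j x : I01 x -> derive_in_n I01 j (0 : R -> V) x = 0.
Proof.
elim: j x => [//|j IH] x Ix /=.
rewrite (@derive_in_eq _ (0 : R -> V))//.
have FF := within_I01_proper Ix.
rewrite /derive_in; under eq_fun do rewrite subrr scaler0.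
exact: lim_cst.
Qed.

Lemma class_C_in0 k : class_C_in I01 k (0 : R -> V).
Proof.
split => j jk.
  have /subspace_eq_continuous : {in (I01 : set R),
      (0 : R -> V) =1 derive_in_n I01 j 0}.
    by move=> x /set_mem Ix; rewrite derive_in_n0.
  by apply; move=> x; exact: cvg_cst.
move=> x Ix; apply: (@derivable_in_eq 0) => //.
  by move=> y Iy; rewrite derive_in_n0.
have FF := within_I01_proper Ix.
rewrite /derivable_in; under eq_fun do rewrite subrr scaler0.
exact: is_cvg_cst.
Qed.

Lemma class_C_in_eq k f g : (forall y, I01 y -> f y = g y) ->
  class_C_in I01 k f -> class_C_in I01 k g.
Proof.
move=> fg [cf df].
have E j : forall y, I01 y -> derive_in_n I01 j f y = derive_in_n I01 j g y.
  elim: j => [//|j IH] y Iy; exact: derive_in_eq.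
split => j jk.
  have /subspace_eq_continuous : {in (I01 : set R),
      derive_in_n I01 j f =1 derive_in_n I01 j g}.
    by move=> x /set_mem Ix; rewrite E.
  by apply; exact: cf.
by move=> x Ix; apply: (derivable_in_eq (E j)) => //; exact: df.
Qed.

Lemma sup_norm01_has_sup f : {within I01, continuous f} ->
  has_sup [set `|f x| | x in (I01 : set R)].
Proof.
move=> cf; split.
  by exists `|f 0|, 0 => //; rewrite /I01 /= in_itv /= lexx ler01.
have [|c cI Hc] := @EVT_max R (fun x => `|f x|) 0 1 ler01.
  by move=> x; apply: cvg_norm; exact: cf.
by exists `|f c| => _ [x Ix <-]; exact: Hc.
Qed.

Lemma sup_norm01_ge f : {within I01, continuous f} ->
  forall x, I01 x -> `|f x| <= sup_norm01 f.
Proof.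
by move=> cf x Ix; apply: sup_ubound; [case: (sup_norm01_has_sup cf)|exists x].
Qed.

Lemma sup_norm01_le f c : (forall x, I01 x -> `|f x| <= c) ->
  sup_norm01 f <= c.
Proof.
move=> fc; apply: sup_le_ub.
  by exists `|f 0|, 0 => //; rewrite /I01 /= in_itv /= lexx ler01.
by move=> _ [x Ix <-]; exact: fc.
Qed.

Lemma Cnorm_ge0 k f : 0 <= Cnorm k f.
Proof. exact: bigmax_ge_id. Qed.

Lemma Cnorm_ge k f : class_C_in I01 k f ->
  forall j, (j <= k)%N -> forall x, I01 x -> `|derive_in_n I01 j f x| <= Cnorm k f.
Proof.
move=> [cf _] j jk x Ix; apply: le_trans (sup_norm01_ge (cf _ jk) Ix) _.
exact: (@le_bigmax _ _ _ _ (fun j : 'I_k.+1 => sup_norm01 (derive_in_n I01 j f))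
  (Ordinal (jk : (j < k.+1)%N))).
Qed.

Lemma Cnorm_le k f c : 0 <= c ->
  (forall j, (j <= k)%N -> forall x, I01 x -> `|derive_in_n I01 j f x| <= c) ->
  Cnorm k f <= c.
Proof.
move=> c0 H; apply: bigmax_le => // i _; apply: sup_norm01_le => x Ix.
by apply: H => //; rewrite -ltnS.
Qed.

End DeriveInTheory.

(* Elements are represented by their extension by 0 outside [0, 1], so that
   Leibniz equality is equality of functions on [0, 1]. *)
Section Cspace.
Context {R : realType}.

Definition Cpred (k : nat) (V : normedModType R) : {pred R -> V} :=
  mem [set f : R -> V | class_C_in I01 k f /\ forall x, ~ I01 x -> f x = 0].
#[local] Arguments Cpred k V : clear implicits.

Record Cspace (k : nat) (V : normedModType R) := MkCspace {
  Cfun :> R -> V ;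
  CfunP : Cfun \in Cpred k V }.

End Cspace.
Arguments Cpred {R} k V.

Section CspaceTheory.
Context {R : realType} {k : nat} {V : normedModType R}.

HB.instance Definition _ := [isSub for @Cfun R k V].
HB.instance Definition _ := [Choice of Cspace k V by <:].

Lemma Cpred_submod_closed : submod_closed (Cpred k V).
Proof.
split; first by rewrite inE; split => //; exact: class_C_in0.
move=> a f g; rewrite !inE => -[Cf f0] [Cg g0]; split.
  exact: class_C_in_lin.
by move=> x Ix; rewrite -[LHS]/(a *: f x + g x) f0// g0// scaler0 addr0.
Qed.

HB.instance Definition _ := GRing.isSubmodClosed.Build _ _ (Cpred k V)
  Cpred_submod_closed.
HB.instance Definition _ := [SubChoice_isSubLmodule of Cspace k V by <:].

Implicit Types f g : Cspace k V.

Lemma Cfun_class f : class_C_in I01 k f.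
Proof. by have := CfunP f; rewrite inE => -[]. Qed.

Lemma Cfun_out f x : ~ I01 x -> f x = 0.
Proof. by have := CfunP f; rewrite inE => -[_]; exact. Qed.

Let nm f : R := Cnorm k f.

Lemma Cspace_normD f g : nm (f + g) <= nm f + nm g.
Proof.
apply: Cnorm_le => [|j jk x Ix]; first by rewrite addr_ge0 // Cnorm_ge0.
have -> : (Cfun (f + g)) = 1 *: Cfun f + Cfun g by rewrite scale1r.
rewrite (derive_in_n_lin _ (Cfun_class f) (Cfun_class g))// scale1r.
apply: le_trans (ler_normD _ _) _.
by apply: lerD; apply: Cnorm_ge => //; exact: Cfun_class.
Qed.

Lemma Cspace_normZ_le (l : R) f : nm (l *: f) <= `|l| * nm f.
Proof.
apply: Cnorm_le => [|j jk x Ix]; first by rewrite mulr_ge0 // Cnorm_ge0.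
have -> : (Cfun (l *: f)) = l *: Cfun f + 0 by rewrite addr0.
rewrite (derive_in_n_lin _ (Cfun_class f) (class_C_in0 k))//.
rewrite derive_in_n0// addr0 normrZ ler_wpM2l//.
by apply: Cnorm_ge => //; exact: Cfun_class.
Qed.

Lemma Cspace_normZ (l : R) f : nm (l *: f) = `|l| * nm f.
Proof.
apply/eqP; rewrite eq_le Cspace_normZ_le /=.
have [->|l0] := eqVneq l 0; first by rewrite normr0 mul0r; exact: Cnorm_ge0.
rewrite -[f in leLHS](scalerK l0) -ler_pdivlMl ?normr_gt0// -normfV.
exact: Cspace_normZ_le.
Qed.

Lemma Cspace_norm_eq0 f : nm f = 0 -> f = 0.
Proof.
move=> f0; apply/val_inj/funext => x.
have [Ix|Ix] := pselect (I01 x); last by rewrite [LHS]Cfun_out.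
apply/eqP; rewrite -normr_le0 -f0.
exact: (Cnorm_ge (Cfun_class f) (leq0n k) Ix).
Qed.

HB.instance Definition _ := @Lmodule_isNormed.Build R (Cspace k V) nm
  Cspace_normD Cspace_normZ Cspace_norm_eq0.

Lemma Cspace_normE f : `|f| = Cnorm k f.
Proof. by []. Qed.

(* The element of C^k([0,1]; V) defined by the restriction of f to [0, 1]; it
   defaults to 0 when that restriction is not of class C^k. *)
Definition toC (f : R -> V) : Cspace k V :=
  insubd (0 : Cspace k V) (fun x => if x \in (I01 : set R) then f x else 0).

Lemma toCE (f : R -> V) : class_C_in I01 k f ->
  forall x, I01 x -> toC f x = f x.
Proof.
move=> Cf x Ix; rewrite /toC -[Cfun _]/(val _) val_insubd ifT.
  by rewrite mem_set.
rewrite inE; split; last by move=> y Iy; rewrite memNset.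
by apply: class_C_in_eq Cf => y Iy; rewrite mem_set.
Qed.

End CspaceTheory.
Arguments toC {R} k {V} f.

Section System.
Context {R : realType} {n : nat}.
Variables (F : 'cV[R]_n -> 'M[R]_n) (G : 'cV[R]_n -> 'cV[R]_n).
Local Notation V := 'cV[R]_n.

(* ((D^k H)(u)) = ((D^(k-1) H)'(u)) (F(u) u_x), where D^(k-1) H is a map on
   C^(k-1)([0,1]; R^n) and the prime is its Frechet derivative at u, seen as an
   element of that space.  For smooth F and u of class C^k both arguments of
   toC are of class C^(k-1), so its default value is not used. *)
Fixpoint Dpow (H : Cspace 0 V -> Cspace 0 V) (k : nat) :
    Cspace k V -> Cspace 0 V :=
  match k return Cspace k V -> Cspace 0 V with
  | 0 => H
  | k'.+1 => fun u =>
      'd (@Dpow H k') (toC k' u)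
        (toC k' (fun x => F (u x) *m derive_in I01 u x))
  end.

Definition superposition : Cspace 0 V -> Cspace 0 V := fun v => toC 0 (G \o v).

Definition compatible (m : nat) (u0 : Cspace m V) : Prop :=
  forall k, (k <= m)%N ->
    Dpow id (toC k u0) 0 = Dpow superposition (toC k u0) 1.

Definition is_solution (m : nat) (u0 : Cspace m V) (u : R -> R -> V) : Prop :=
  [/\ class_C_strip m u,
      forall t x, Rplus t -> I01 x -> dt u t x + F (u t x) *m dx u t x = 0,
      forall t, Rplus t -> u t 0 = G (u t 1) &
      forall x, I01 x -> u 0 x = u0 x].

Definition exponentially_stable (m : nat) : Prop :=
  exists eps nu C : R,
    [/\ 0 < eps, 0 < nu, 0 < C &
      forall u0 : Cspace m V, compatible u0 -> `|u0| <= eps ->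
        exists u : R -> R -> V,
          [/\ is_solution u0 u,
              forall v, is_solution u0 v ->
                forall t x, Rplus t -> I01 x -> v t x = u t x &
              forall t, 0 < t -> Cnorm m (u t) <= C * expR (- nu * t) * `|u0|]].

End System.

(* Main.v *)
(* Each component is constant along its characteristics, so the traces
   v = u(., 0) and w = u(., 1) satisfy v = K w and
   w_i(t + 1 / speed_i(v_i(t))) = v_i(t): a system whose delays depend on its
   solution.  Take K = 1/2 [[1, 1], [1, -1]] and the speeds 1 - u_0^2, sqrt 2.
   K is symmetric with eigenvalues 1/sqrt 2 and -1/sqrt 2, which gives rho_0 and
   rho_2, while the absolute values in each row add up to 1.

   Followed back in time through the reflections, v_0(T) is a mean of values of
   the initial data, one per word in the two components, with signs.  For fixed
   delays, words with the same letters meet at the same point and cancel.  On top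
   of a small locally constant base state the delays differ from one reflection
   to the next, and the words reach distinct points.  A bump of height E eta^m and
   width eta with the right sign is put at each of these points: all of them add
   up at time T to a bump of the same height and width, so the m-th derivative
   has not decayed, although T is arbitrarily large. *)
Require Import Defs.
From mathcomp Require Import all_boot all_order all_algebra.
From mathcomp Require Import all_classical all_reals all_analysis.
From mathcomp Require Import ring lra complex.

Import Order.TTheory GRing.Theory Num.Theory.
Import numFieldNormedType.Exports.

Local Open Scope classical_set_scope.
Local Open Scope ring_scope.

Set Implicit Arguments.
Unset Strict Implicit.
Unset Printing Implicit Defensive.

(** * The boundary matrix *)

Section Kmatrix.
Context {p : nat}.
Local Notation n := p.+2.

(** Stability is refuted by a ratio that does not see T. Just before each bump, in time, the data
    keep the base value on an interval, and these plateaus arrive together too. In the final slice a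
    plateau then lies within eta of a value that differs by E eta^m; since all derivatives vanish on
    the plateau, this forces an m-th derivative of size at least E. The data have norm at most E (1
    + 4^m M) with M depending on m only, so T can be chosen after C and nu. The base state follows
    the eigenvector (1, sqrt 2 - 1) of K. Each reflection back in time multiplies it by sqrt 2,
    hence doubles the square that governs the delay of the first component: the added delays act as
    binary digits. As 1 and 1/sqrt 2 are independent over the integers, words that meet for fixed
    delays have equal letter counts and ask for the same base value. The scales are chosen in the
    order E, delta, eta: the separation of the perturbed points, and so eta, is known only once
    delta is fixed. Existence of the solution and the bound on its gradient both come from the
    assumed stability. *)

Definition active (b : bool) : 'I_n := if b then lift ord0 ord0 else ord0.

Lemma big_comp (S : nmodType) (f : 'I_n -> S) :
  \sum_i f i = f (active false) + f (active true) + \sum_j f (lift ord0 (lift ord0 j)).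
Proof. by rewrite 2!big_ord_recl addrA. Qed.

Lemma ordP (i : 'I_n) :
  [\/ i = active false, i = active true | exists j, i = lift ord0 (lift ord0 j)].
Proof.
case: (unliftP ord0 i) => [j ->|->]; last by constructor 1.
case: (unliftP ord0 j) => [l ->|->]; last by constructor 2.
by constructor 3; exists l.
Qed.

(* h [[1, 1], [1, -1]], padded with zeros. *)
Definition Kmx {S : nzRingType} (h : S) : 'M[S]_n := \matrix_(i, j)
  (if (i < 2)%N && (j < 2)%N then (-1) ^+ (i * j)%N * h else 0).

Lemma Kmx_mul {S : comNzRingType} (h : S) q (X : 'M[S]_(n, q)) j :
  ((Kmx h *m X) (active false) j = h * (X (active false) j + X (active true) j)) *
  ((Kmx h *m X) (active true) j = h * (X (active false) j - X (active true) j)) *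
  (forall k, (Kmx h *m X) (lift ord0 (lift ord0 k)) j = 0).
Proof.
(do ?split) => [||k]; rewrite mxE big_comp !mxE/= ?mulrDr ?mul1r ?mulN1r ?expr0 ?mul1r ?expr1.
- by rewrite big1 ?addr0// => i _; rewrite mxE/= mul0r.
- by rewrite big1 ?addr0 ?mulNr ?mulrN ?mul1r// => i _; rewrite mxE/= mul0r.
- by rewrite big1 ?addr0 ?mul0r ?addr0// => i _; rewrite mxE/= mul0r.
Qed.

Lemma tr_Kmx {S : comNzRingType} (h : S) : (Kmx h)^T = Kmx h.
Proof. by apply/matrixP => i j; rewrite !mxE andbC mulnC. Qed.

Lemma map_Kmx {S S' : nzRingType} (f : {rmorphism S -> S'}) (h : S) :
  map_mx f (Kmx h) = Kmx (f h).
Proof.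
apply/matrixP => i j; rewrite !mxE.
by case: ifP; rewrite ?rmorph0// rmorphM/= rmorphXn/= rmorphN1.
Qed.

End Kmatrix.

(** * Norms and spectral radii of the boundary matrix *)

Section Krho.
Context {R : realType} {p : nat}.
Local Notation n := p.+2.
Local Notation K := (Kmx (2^-1) : 'M[R]_n).

Lemma jacobian_mulmx (M : 'M[R]_n) : jacobian_mx (mulmx M) 0 = M.
Proof.
apply/matrixP => i j; rewrite mxE.
have -> : 'D_(delta_mx j 0) (mulmx M : 'cV[R]_n -> 'cV[R]_n) 0 = M *m delta_mx j 0.
  apply: cvg_lim => //.
  apply: (cvg_trans (G := nbhs (M *m delta_mx j (0 : 'I_1)))); last exact: cvg_id.
  apply: (@cvg_trans _ ((fun=> M *m delta_mx j (0 : 'I_1)) @ (0 : R)^')); last exact: cvg_cst.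
  apply: near_eq_cvg; near=> h.
  rewrite /= addr0 mulmx0 subr0 -scalemxAr scalerA mulVf ?scale1r//.
  by near: h; exact: nbhs_dnbhs_neq.
rewrite mxE (bigD1 j)//= big1 ?addr0; last first.
  by move=> l lj; rewrite mxE (negPf lj) mulr0.
by rewrite mxE !eqxx mulr1.
Unshelve. all: by end_near. Qed.

Lemma lpnorm_ge0 q (x : 'cV[R]_n) : 0 <= lpnorm q x.
Proof.
case: q => [q| |] //=; first exact: powR_ge0.
exact: bigmax_ge_id.
Qed.

Lemma opnorm_ge0 q (M : 'M[R]_n) : 0 <= opnorm q M.
Proof.
rewrite /opnorm; have [/[dup] supS [[y [x x1 _]] _]|/sup_out ->//] :=
  pselect (has_sup [set lpnorm q (M *m x) | x in [set x | lpnorm q x = 1]]).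
apply: le_trans (lpnorm_ge0 q (M *m x)) _.
by apply: ub_le_sup; [case: supS|exists x].
Qed.

Lemma opnorm_le q (M : 'M[R]_n) c : 0 <= c ->
  (forall x, lpnorm q x = 1 -> lpnorm q (M *m x) <= c) -> opnorm q M <= c.
Proof.
move=> c0 Mc; rewrite /opnorm.
have [->|/set0P ne] := eqVneq [set lpnorm q (M *m x) | x in [set x | lpnorm q x = 1]] set0.
  by rewrite sup0.
by apply: ge_sup => // _ [x /= x1 <-]; exact: Mc.
Qed.

Lemma hat_rho_le_opnorm q (M : 'M[R]_n) : hat_rho q M <= opnorm q M.
Proof.
apply: ge_inf; first by exists 0 => _ [d _ <-]; exact: opnorm_ge0.
exists (const_mx 1); first by move=> i; rewrite mxE ltr01.
by rewrite diag_const_mx invmx1 mulmx1 mul1mx.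
Qed.

Lemma hat_rho_K_oo : hat_rho +oo%E K <= 1.
Proof.
apply: le_trans (hat_rho_le_opnorm _ _) _; apply: opnorm_le => // x x1.
have xi i : `|x i 0| <= 1 by rewrite -x1; exact: (le_bigmax _ (fun i => `|x i 0|)).
apply: bigmax_le => // i _.
have := xi (active false); have := xi (active true).
rewrite !ler_norml => /andP[? ?] /andP[? ?].
by have [->|->|[j ->]] := ordP i; rewrite Kmx_mul; apply/andP; split; lra.
Qed.

#[local] Arguments lpnorm {R n} p x : simpl never.

Lemma lpnorm2E (x : 'cV[R]_n) : lpnorm 2%:E x = Num.sqrt (\sum_i x i 0 ^+ 2).
Proof.
rewrite /lpnorm powR12_sqrt; last by apply: sumr_ge0 => i _; exact: powR_ge0.
by congr Num.sqrt; apply: eq_bigr => i _; rewrite powR_mulrn// real_normK// num_real.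
Qed.

Local Notation s := (Num.sqrt 2^-1 : R).

Let s_gt0 : 0 < s. Proof. by rewrite sqrtr_gt0 invr_gt0. Qed.
Let s_sqr : s ^+ 2 = 2^-1. Proof. by rewrite sqr_sqrtr// invr_ge0. Qed.

(** By the parallelogram identity, K multiplies the Euclidean norm of the first two coordinates by
    1/sqrt 2; it kills the others. *)
Lemma opnorm2_K : opnorm 2%:E K <= s.
Proof.
apply: opnorm_le => [|x]; first exact: ltW.
rewrite !lpnorm2E => x1; rewrite ler_sqrt ?invr_gt0//.
have {x1} : \sum_i x i 0 ^+ 2 = 1.
  have S0 : 0 <= \sum_i x i 0 ^+ 2 by apply: sumr_ge0 => i _; exact: sqr_ge0.
  by rewrite -(sqr_sqrtr S0) x1 expr1n.
rewrite !big_comp => x1; rewrite !Kmx_mul.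
rewrite [X in _ + X]big1 ?addr0; last by move=> j _; rewrite Kmx_mul expr0n.
set r := \sum_j _ in x1.
have r0 : 0 <= r by apply: sumr_ge0 => i _; exact: sqr_ge0.
rewrite (_ : _ + _ = 2^-1 * (x (active false) 0 ^+ 2 + x (active true) 0 ^+ 2)); first by lra.
by field.
Qed.

Definition eigK : 'cV[R]_n :=
  \col_i (if i == active false then 1 else if i == active true then 2 * s - 1 else 0).

Lemma eigKP : K *m eigK = s *: eigK.
Proof.
apply/colP => i; rewrite !mxE.
have -> : (\sum_j K i j * eigK j 0) = (K *m eigK) i 0 by rewrite mxE.
have [->|->|[j ->]] := ordP i; rewrite Kmx_mul ?mxE /= ?mulr0//; first by field.
move: s_sqr; rewrite expr2 => e.
have -> : s * (2 * s - 1) = 2 * (s * s) - s by ring.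
by rewrite e; field.
Qed.

Lemma lpnorm2Z (a : R) (x : 'cV[R]_n) : lpnorm 2%:E (a *: x) = `|a| * lpnorm 2%:E x.
Proof.
rewrite !lpnorm2E -sqrtr_sqr -sqrtrM ?sqr_ge0//; congr Num.sqrt.
by rewrite mulr_sumr; apply: eq_bigr => i _; rewrite mxE exprMn.
Qed.

Lemma opnorm2_has_sup (M : 'M[R]_n) :
  has_ubound [set lpnorm 2%:E (M *m x) | x in [set x | lpnorm 2%:E x = 1]].
Proof.
exists (Num.sqrt (\sum_i (\sum_j `|M i j|) ^+ 2)) => _ [x /= x1 <-].
rewrite lpnorm2E; apply: ler_wsqrtr; apply: ler_sum => i _.
rewrite -real_normK ?num_real// lerXn2r ?nnegrE//; first exact: sumr_ge0.
rewrite mxE; apply: le_trans (ler_norm_sum _ _ _) _; apply: ler_sum => j _.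
rewrite normrM ler_piMr// -x1 lpnorm2E -sqrtr_sqr; apply: ler_wsqrtr.
by rewrite (bigD1 j)//= lerDl sumr_ge0// => l _; exact: sqr_ge0.
Qed.

(** Conjugation by [D] keeps the eigenvalue 1/sqrt 2, with eigenvector [D *m eigK], so no weight
    brings the norm below it; the identity weight attains it. *)
Lemma hat_rho2_K : hat_rho 2%:E K = s.
Proof.
apply/eqP; rewrite eq_le (le_trans (hat_rho_le_opnorm _ _) opnorm2_K)/=.
apply: lb_le_inf.
  by exists (opnorm 2%:E (diag_mx (const_mx 1) *m K *m invmx (diag_mx (const_mx 1)))),
    (const_mx 1) => //= i; rewrite mxE ltr01.
move=> _ [d d0 <-]; set D := diag_mx d.
have uD : D \in unitmx.
  by rewrite unitmxE det_diag unitfE; apply/prodf_neq0 => i _; rewrite gt_eqF// d0.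
set y := D *m eigK.
have y0 : 0 < lpnorm 2%:E y.
  rewrite lpnorm2E sqrtr_gt0 (bigD1 (active false))//= ltr_wpDr//.
    by apply: sumr_ge0 => i _; exact: sqr_ge0.
  by rewrite /y mul_diag_mx !mxE/= mulr1 exprn_gt0.
apply: ub_le_sup; first exact: opnorm2_has_sup.
exists ((lpnorm 2%:E y)^-1 *: y) => /=.
  by rewrite lpnorm2Z ger0_norm ?invr_ge0 ?lpnorm_ge0// mulVf ?gt_eqF.
rewrite -scalemxAr -!mulmxA mulKmx// eigKP -!scalemxAr scalerA -/y lpnorm2Z.
rewrite normrM !ger0_norm ?invr_ge0 ?lpnorm_ge0 ?ltW//.
by rewrite mulrAC mulVf ?gt_eqF// mul1r.
Qed.

Local Notation nc := (@ComplexField.Normc.normc R).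
Let sqn (z : R[i]) : R := nc z ^+ 2.

Let sqnE (z : R[i]) : sqn z = complex.Re z ^+ 2 + complex.Im z ^+ 2.
Proof. by case: z => a b; rewrite /sqn /= sqr_sqrtr// addr_ge0 ?sqr_ge0. Qed.

Let sqn_ge0 (z : R[i]) : 0 <= sqn z. Proof. exact: sqr_ge0. Qed.

Let sqnM (x y : R[i]) : sqn (x * y) = sqn x * sqn y.
Proof. by rewrite /sqn ComplexField.Normc.normcM exprMn. Qed.

(** Phases are unitary, so the Euclidean bound on K controls every eigenvalue. [eigenvalue] is about
    row vectors; the symmetry of K turns y K into the transpose of K y^T. *)
Lemma normc_eigenvalue_phase_K (theta : 'I_n -> R) (a : R[i]) :
  eigenvalue (phase_mx theta *m map_mx (real_complex R) K) a -> nc a <= s.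
Proof.
move=> /eigenvalueP[v va v0].
have -> : nc a = Num.sqrt (sqn a).
  by rewrite sqrtr_sqr ger0_norm//; case: (a) => ? ?; exact: sqrtr_ge0.
apply: ler_wsqrtr.
pose y := v *m phase_mx theta.
have yv j : sqn (y 0 j) = sqn (v 0 j).
  rewrite /y mul_mx_diag !mxE sqnM [X in _ * X]sqnE/= cos2Dsin2 mulr1//.
have ya : y *m Kmx (real_complex R 2^-1) = a *: v.
  by rewrite -va mulmxA map_Kmx.
have yT j : (a *: v) 0 j = (Kmx (real_complex R 2^-1) *m y^T) j 0.
  by rewrite -ya -[y in LHS]trmxK -[Kmx _ in LHS]tr_Kmx -trmx_mul mxE.
have Sv : sqn a * \sum_j sqn (v 0 j) <= 2^-1 * \sum_j sqn (v 0 j).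
  have -> : sqn a * \sum_j sqn (v 0 j) = \sum_j sqn ((a *: v) 0 j).
    by rewrite mulr_sumr; apply: eq_bigr => j _; rewrite mxE sqnM.
  under eq_bigr do rewrite yT.
  rewrite -(eq_bigr _ (fun j _ => yv j)) !big_comp !Kmx_mul.
  rewrite [X in _ + X]big1; last by move=> j _; rewrite Kmx_mul sqnE/= !expr0n addr0.
  rewrite ![y^T _ _]mxE.
  set r := \sum_j _.
  have r0 : 0 <= r by apply: sumr_ge0 => i _; exact: sqn_ge0.
  move: (y 0 (active false)) (y 0 (active true)) => [x1 x2] [y1 y2].
  rewrite !sqnE/= -subr_ge0 !(mul0r, subr0, addr0).
  by rewrite (_ : _ - _ = 2^-1 * r); [rewrite mulr_ge0|field].
have Sv0 : 0 < \sum_j sqn (v 0 j).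
  have [j vj] : exists j, v 0 j != 0.
    apply/existsP; apply: contraNT v0 => /existsPn H; apply/eqP/rowP => j.
    by rewrite mxE; apply/eqP; rewrite -[_ == _]negbK; exact: H.
  rewrite (bigD1 j)//= ltr_wpDr//; first by apply: sumr_ge0 => i _; exact: sqn_ge0.
  rewrite /sqn exprn_even_gt0//=; apply: contra vj => /eqP /ComplexField.Normc.eq0_normc ->.
  by [].
by move: Sv; rewrite ler_pM2r.
Qed.

Lemma hat_rho0_K : hat_rho0 K = s.
Proof.
have sr th : spectral_radius (phase_mx th *m map_mx (real_complex R) K) <= s.
  set S := [set nc a | a in
    [set a | eigenvalue (phase_mx th *m map_mx (real_complex R) K) a]].
  rewrite /spectral_radius -/S.
  have [->|/set0P ne] := eqVneq S set0; first by rewrite sup0 ltW.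
  by apply: ge_sup => // _ [a /= /normc_eigenvalue_phase_K ? <-].
apply/eqP; rewrite eq_le; apply/andP; split.
  apply: ge_sup; first by exists (spectral_radius
    (phase_mx (fun=> 0) *m map_mx (real_complex R) K)), (fun=> 0).
  by move=> _ [th _ <-].
apply: (@le_trans _ _ (spectral_radius (phase_mx (fun=> 0) *m map_mx (real_complex R) K))).
  have -> : s = nc (real_complex R s).
    by rewrite /= expr0n addr0 sqrtr_sqr ger0_norm// ltW.
  apply: ub_le_sup.
    by exists s => _ [a /= /normc_eigenvalue_phase_K ? <-].
  exists (real_complex R s) => //=.
  have -> : phase_mx (fun=> 0) = 1%:M :> 'M[R[i]]_n.
    rewrite -diag_const_mx; congr diag_mx; apply/rowP => j.
    by rewrite !mxE cos0 sin0.
  rewrite mul1mx; apply/eigenvalueP; exists (map_mx (real_complex R) eigK^T).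
    rewrite -map_mxM -[K in LHS]tr_Kmx -trmx_mul eigKP; apply/rowP => j.
    by rewrite !mxE rmorphM.
  apply/negP => /eqP/rowP /(_ (active false)); rewrite !mxE/= => /eqP.
  by rewrite oner_eq0.
apply: ub_le_sup; last by exists (fun=> 0).
by exists s => _ [th _ <-].
Qed.

Lemma hat_rho2_K_lt1 : hat_rho 2%:E K < 1.
Proof.
by rewrite hat_rho2_K -[ltRHS]sqrtr1 ltr_sqrt ?ltr01//; lra.
Qed.

End Krho.

(** * The velocities *)

Section Fsystem.
Context {R : realType}.

Lemma class_C_cst {V W : normedModType R} (a : W) k : class_C k (fun _ : V => a).
Proof.
elim: k a => [|k IH] a; first by move=> x; exact: cvg_cst.
split => [x|v]; first exact: differentiable_cst.
rewrite [X in class_C k X](_ : _ = fun=> 0); first exact: IH.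
by apply/funext => x; rewrite derive_cst.
Qed.

Section Coord.
Context {n : nat} {W : normedModType R}.
Local Notation V := 'cV[R]_n.
Variable i : 'I_n.
Local Notation c := (fun u : V => u i 0).

Lemma derive_coord (u v : V) : 'D_v c u = v i 0.
Proof.
apply: cvg_lim => //; apply: (@cvg_trans _ ((fun=> v i 0) @ (0 : R)^')); last exact: cvg_cst.
apply: near_eq_cvg; near=> h.
rewrite /= !mxE addrK -[_ *: _]/(_ * (_ * _)) mulrA mulVf ?mul1r//.
by near: h; exact: nbhs_dnbhs_neq.
Unshelve. all: by end_near. Qed.

Lemma class_C_coordZ (w : W) k : class_C k (fun u : V => u i 0 *: w).
Proof.
have dc (u : V) := @differentiable_coord R n 1 u i 0.
case: k => [|k].
  move=> x; apply: (differentiable_continuous (f := fun u : V => u i 0 *: w)).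
  exact: differentiableZl.
split => [x|v]; first exact: differentiableZl.
rewrite [X in class_C k X](_ : _ = fun=> v i 0 *: w); first exact: class_C_cst.
apply/funext => x; rewrite deriveE; last exact: differentiableZl.
by rewrite diffZl// -deriveE// derive_coord.
Qed.

(** The velocity matrix has this form, with [W] the space of matrices; one differentiation makes it
    linear in the coordinate. *)
Lemma class_C_sqr_coordZ (a w : W) k : class_C k (fun u : V => a - (u i 0) ^+ 2 *: w).
Proof.
have dc (u : V) := @differentiable_coord R n 1 u i 0.
have dc2 (u : V) : differentiable (fun u : V => (u i 0) ^+ 2) u.
  exact: (@differentiableX _ _ c 1 u (dc u)).
have dw (u : V) : differentiable (fun u : V => (u i 0) ^+ 2 *: w) u.
  exact: differentiableZl.
have da (u : V) : differentiable (fun u : V => a - (u i 0) ^+ 2 *: w) u.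
  exact: (@differentiableB _ _ _ (cst a)).
case: k => [|k].
  by move=> x; exact: differentiable_continuous.
split => // v.
rewrite [X in class_C k X](_ : _ = fun u : V => u i 0 *: (- (2 * v i 0) *: w)).
  exact: class_C_coordZ.
apply/funext => x; rewrite (deriveB (f := cst a)); last first.
- exact: diff_derivable.
- exact: derivable_cst.
rewrite derive_cst sub0r deriveE// diffZl// -deriveE//.
have -> : 'D_v (fun u : V => u i 0 ^+ 2) x = (2 * x i 0 ^+ 1) *: 'D_v c x.
  exact: (@deriveX R V c 2 x v (diff_derivable (dc x))).
by rewrite derive_coord scalerA -scaleNr; congr (_ *: w); rewrite /= /GRing.scale /=; ring.
Qed.

End Coord.

Context {p : nat}.
Local Notation n := p.+2.
Local Notation V := 'cV[R]_n.

(** Index 1 gets sqrt 2 in place of 2: this keeps all speeds distinct and makes the two active ones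
    incommensurable. *)
Definition speed_at0 (i : 'I_n) : R :=
  if i == active true then Num.sqrt 2 else i.+1%:R.

Definition Fsys (u : V) : 'M[R]_n :=
  diag_mx (\row_i speed_at0 i) -
  (u (active false) 0) ^+ 2 *: delta_mx (active false) (active false).

Definition speed (b : bool) (c : R) : R := if b then Num.sqrt 2 else 1 - c ^+ 2.

Lemma smooth_Fsys : smooth Fsys.
Proof. by move=> k; exact: class_C_sqr_coordZ. Qed.

Lemma Fsys_entry u i j : Fsys u i j =
  (i == j)%:R * (speed_at0 i - (i == active false)%:R * (u (active false) 0) ^+ 2).
Proof.
rewrite !mxE; case: (eqVneq i j) => [->|ij].
  by rewrite mulr1n mul1r andbb mulrC.
rewrite mulr0n mul0r sub0r; apply/eqP; rewrite oppr_eq0 mulf_eq0.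
apply/orP; right; rewrite pnatr_eq0 eqb0; apply/negP => /andP[/eqP ei /eqP ej].
by rewrite ei ej eqxx in ij.
Qed.

Lemma is_diag_Fsys u : is_diag_mx (Fsys u).
Proof.
apply/is_diag_mxP => i j; rewrite Fsys_entry -[_ != _ :> nat]/(i != j).
by move=> /negPf ->; rewrite mul0r.
Qed.

Lemma Fsys_mul (b : bool) (u x : V) :
  (Fsys u *m x) (active b) 0 = speed b (u (active b) 0) * x (active b) 0.
Proof.
rewrite mxE (bigD1 (active b))//= big1 ?addr0 => [|j jb].
  rewrite Fsys_entry eqxx mul1r; congr (_ * _).
  by case: b; rewrite /speed_at0 /= ?mul0r ?subr0// mul1r.
by rewrite Fsys_entry eq_sym (negPf jb) !mul0r.
Qed.

Lemma eigenvalues_Fsys0 : distinct_positive_eigenvalues (Fsys 0).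
Proof.
have s0 : (0 : R) <= 2 by [].
have s2 : Num.sqrt 2 ^+ 2 = 2 :> R by rewrite sqr_sqrtr.
have sN k : Num.sqrt 2 <> k%:R :> R.
  move=> /(congr1 (fun x => x ^+ 2)); rewrite s2 -natrX => /eqP.
  rewrite eqr_nat; case: k => [|[|k]]//.
  by move=> /eqP e; have := leq_sqr 2 k.+2; rewrite -e.
exists speed_at0; split => [i j|i].
  rewrite /speed_at0; case: ifP => [/eqP ->|_]; case: ifP => [/eqP ->|_] //.
  - by move=> /sN.
  - by move=> /esym /sN.
  - by move=> /eqP; rewrite eqr_nat eqSS => /eqP /val_inj.
split; first by rewrite /speed_at0; case: ifP => _; rewrite ?sqrtr_gt0 ?ltr0n.
apply/eigenvalueP; exists (delta_mx 0 i); last first.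
  by apply/negP => /eqP /rowP /(_ i); rewrite !mxE !eqxx => /eqP; rewrite oner_eq0.
apply/rowP => j; rewrite -rowE [LHS]mxE [RHS]mxE Fsys_entry !mxE.
by rewrite expr0n mulr0 subr0 eqxx/= mulrC eq_sym.
Qed.

End Fsystem.

(** * Bump functions *)

Section FiniteSmoothness.
Context {R : realType}.
Implicit Types (f g : R -> R).

Fixpoint Ck (k : nat) f : Prop :=
  match k with
  | 0 => continuous f
  | k'.+1 => (forall x, derivable f x 1) /\ Ck k' f^`()%classic
  end.

Lemma Ck_derive k f g : (forall x, is_derive x (1 : R) f (g x)) -> Ck k g -> Ck k.+1 f.
Proof.
move=> fg gk; split => [x|]; first by case: (fg x).
rewrite (_ : f^`()%classic = g)//; apply/funext => x; rewrite derive1E.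
by case: (fg x).
Qed.

Lemma is_derive_derive1 f : (forall x, derivable f x 1) ->
  forall x, is_derive x (1 : R) f (f^`()%classic x).
Proof. by move=> df x; rewrite derive1E; exact: derivableP. Qed.

Lemma Ck_continuous k f : Ck k f -> continuous f.
Proof.
case: k => [//|k] [df _] x; apply: differentiable_continuous.
exact/derivable1_diffP.
Qed.

Lemma CkW k f : Ck k.+1 f -> Ck k f.
Proof.
elim: k f => [|k IH] f [df fk]; first by apply: (@Ck_continuous 1).
by split => //; exact: IH.
Qed.

Lemma Ck_derive1n k f j : (j <= k)%N -> Ck k f -> Ck (k - j) f^`(j)%classic.
Proof.
elim: j k f => [|j IH] k f; first by rewrite subn0.
by case: k => [//|k] jk [_ fk]; rewrite derive1Sn subSS; exact: IH.
Qed.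

Lemma Ck_derivable1n k f j : (j < k)%N -> Ck k f ->
  forall x, derivable f^`(j)%classic x 1.
Proof. by move=> jk /(Ck_derive1n (ltnW jk)); rewrite -subnSK// => -[]. Qed.

Lemma Ck_cst k c : Ck k (fun=> c).
Proof.
elim: k c => [|k IH] c; first by move=> x; exact: cvg_cst.
apply: (@Ck_derive _ _ (fun=> 0)) => // x; exact: is_derive_cst.
Qed.

Lemma CkD k f g : Ck k f -> Ck k g -> Ck k (fun x => f x + g x).
Proof.
elim: k f g => [|k IH] f g.
  by move=> cf cg x; apply: cvgD; [exact: cf|exact: cg].
move=> [df fk] [dg gk].
apply: (@Ck_derive _ _ (fun x => f^`()%classic x + g^`()%classic x)); last exact: IH.
by move=> x; apply: is_deriveD; exact: is_derive_derive1.
Qed.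

Lemma derive1n_lin k (a : R) f g : Ck k f -> Ck k g -> forall j, (j <= k)%N ->
  (fun x => a * f x + g x)^`(j)%classic = (fun x => a * f^`(j)%classic x + g^`(j)%classic x).
Proof.
elim: k f g => [|k IH] f g; first by move=> _ _ [].
move=> [df fk] [dg gk] [//|j] jk; rewrite !derive1Sn -IH//; congr (_^`(j)%classic).
apply/funext => x; rewrite derive1E.
have D : is_derive x (1 : R) (fun x => a * f x + g x) (a * f^`()%classic x + g^`()%classic x).
  by apply: is_deriveD; [apply: is_deriveZ|]; exact: is_derive_derive1.
by case: D.
Qed.

Lemma CkM k f g : Ck k f -> Ck k g -> Ck k (fun x => f x * g x).
Proof.
elim: k f g => [|k IH] f g.
  by move=> cf cg x; apply: cvgM; [exact: cf|exact: cg].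
move=> [df fk] [dg gk].
apply: (@Ck_derive _ _ (fun x => f x * g^`()%classic x + g x * f^`()%classic x)); last first.
  by apply: CkD; apply: IH => //; exact: CkW.
by move=> x; apply: is_deriveM; exact: is_derive_derive1.
Qed.

Lemma is_derive1_comp f g (x df dg : R) : is_derive (g x) (1 : R) f df ->
  is_derive x (1 : R) g dg -> is_derive x (1 : R) (fun y => f (g y)) (df * dg).
Proof.
move=> [dfx fE] [dgx gE].
have df' : differentiable f (g x) := iffLR (derivable1_diffP _ _) dfx.
have dg' : differentiable g x := iffLR (derivable1_diffP _ _) dgx.
have dfg : derivable (f \o g) x 1 := diff_derivable (differentiable_comp dg' df').
have E : 'D_1 (f \o g) x = df * dg.
  by rewrite -fE -gE -[LHS]derive1E (derive1_comp dgx dfx) [X in X * _]derive1E [X in _ * X]derive1E.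
exact: DeriveDef dfg E.
Qed.

Lemma Ck_comp k f g : Ck k f -> Ck k g -> Ck k (fun x => f (g x)).
Proof.
elim: k f g => [|k IH] f g.
  by move=> cf cg x; apply: continuous_comp; [exact: cg|exact: cf].
move=> [df fk] [dg gk].
apply: (@Ck_derive _ _ (fun x => f^`()%classic (g x) * g^`()%classic x)); last first.
  by apply: CkM => //; apply: IH => //; exact: CkW.
by move=> x; apply: is_derive1_comp; exact: is_derive_derive1.
Qed.

Lemma Ck_affine k (a b : R) : Ck k (fun x => a * x + b).
Proof.
have idk : Ck k (@idfun R).
  case: k => [x|k]; first exact: cvg_id.
  by apply: (@Ck_derive _ _ (fun=> 1)); exact: Ck_cst.
exact: (CkD (CkM (Ck_cst k a) idk) (Ck_cst k b)).
Qed.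

(** The truncated power x_+^k. Data of finite class C^m allow piecewise polynomial bumps. *)
Definition pospow (k : nat) (x : R) : R := Num.max x 0 ^+ k.

Lemma is_derive_pospow k x :
  is_derive x (1 : R) (pospow k.+2) (k.+2%:R * pospow k.+1 x).
Proof.
have [x0|x0|->] := ltgtP x 0.
- rewrite /pospow max_r ?ltW// expr0n mulr0.
  apply: (@near_eq_is_derive _ _ _ (fun=> 0)).
    by near=> y; rewrite max_r ?expr0n//; apply: ltW; near: y; exact: lt_nbhsl.
- rewrite /pospow max_l ?ltW//.
  apply: (@near_eq_is_derive R R R (fun y : R => y ^+ k.+2)).
    by near=> y; rewrite max_l//; apply: ltW; near: y; exact: lt_nbhsr.
  have D : is_derive x (1 : R) (id ^+ k.+2 : R -> R) ((k.+2%:R * x ^+ k.+1) *: 1).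
    exact: is_deriveX.
  rewrite -[X in is_derive _ _ _ X]mulr1.
  rewrite (_ : (fun y => _) = (id ^+ k.+2 : R -> R))//.
  by apply/funext => y; rewrite exprfctE.
rewrite [pospow k.+1 _]/pospow maxxx expr0n mulr0 /pospow.
(* At the kink the difference quotient is at most |h|^(k+1), hence at most |h| for |h| < 1. *)
have H : (fun h : R => h^-1 *: (Num.max (h *: (1 : R) + 0) 0 ^+ k.+2 - Num.max (0 : R) 0 ^+ k.+2))
    @ (0 : R)^' --> (0 : R).
  apply/cvgrPdist_le => e e0; near=> h.
  have h0 : h != 0 by near: h; exact: nbhs_dnbhs_neq.
  have he : `|h| < e by near: h; exact: dnbhs0_lt.
  have h1 : `|h| < 1 by near: h; exact: dnbhs0_lt.
  rewrite maxxx expr0n subr0 sub0r normrN addr0 /GRing.scale/= mulr1.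
  have mh : `|Num.max h 0| <= `|h|.
    by have [h0'|h0'] := leP h 0; rewrite ?normr0.
  rewrite normrM normfV ler_pdivrMl ?normr_gt0// normrX exprS.
  apply: ler_pM => //; rewrite ?exprn_ge0//.
  apply: (le_trans _ (ltW he)); apply: (le_trans _ mh).
  by rewrite exprS ler_piMr// exprn_ile1// (le_trans mh (ltW h1)).
by apply: DeriveDef; [apply/cvg_ex; exists 0; exact: H|exact: cvg_lim H].
Unshelve. all: by end_near. Qed.

Lemma Ck_pospow k : Ck k (pospow k.+1).
Proof.
elim: k => [|k IH].
  rewrite (_ : pospow 1 = fun x => Num.max x 0); last by apply/funext.
  by move=> x; apply: (@continuous_max _ _ id (fun=> 0) x (@cvg_id _ _) (cvg_cst _)).
apply: Ck_derive (is_derive_pospow k) _.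
by apply: CkM => //; exact: Ck_cst.
Qed.

Lemma exists_plateau k : exists phi : R -> R,
  [/\ Ck k phi, forall x, `|x| <= 2^-1 -> phi x = 1 &
      forall x, 1 <= `|x| -> phi x = 0].
Proof.
(* A step from 0 on x <= 0 to 1 on 1 <= x: the kinks of x_+ and of the
   truncation at 1 are smoothed by the power k + 1. *)
pose S (x : R) := 1 + - 1 * pospow k.+1 (- 1 * pospow k.+1 x + 1).
have SCk : Ck k S.
  apply: (CkD (Ck_cst _ _)); apply: (CkM (Ck_cst _ _)).
  apply: (Ck_comp (f := pospow k.+1)); first exact: Ck_pospow.
  apply: (Ck_comp (f := fun x => -1 * x + 1)); first exact: Ck_affine.
  exact: Ck_pospow.
have S0 x : x <= 0 -> S x = 0.
  move=> x0; rewrite /S /pospow (max_r x0) expr0n mulr0 add0r max_l// expr1n.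
  by rewrite mulr1 subrr.
have S1 x : 1 <= x -> S x = 1.
  move=> x1; have x0 : 0 <= x by apply: le_trans x1.
  rewrite /S /pospow (max_l x0) [Num.max _ _]max_r ?expr0n ?mulr0 ?addr0//.
  by rewrite mulN1r addrC subr_le0 exprn_ege1.
exists (fun x => S (2 * x + 2) * S (- 2 * x + 2)); split.
- by apply: CkM; apply: Ck_comp => //; exact: Ck_affine.
- by move=> x; rewrite ler_norml => /andP[? ?]; rewrite !S1 ?mulr1//; lra.
- move=> x; rewrite ler_normr => /orP[x1|x1].
    by rewrite [X in _ * X]S0 ?mulr0//; lra.
  by rewrite S0 ?mul0r//; lra.
Qed.

Lemma derive1_supp f r : (forall x, r < `|x| -> f x = 0) ->
  forall x, r < `|x| -> f^`()%classic x = 0.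
Proof.
move=> f0 x rx; rewrite derive1E (@near_eq_derive _ _ _ f (fun=> 0)).
- exact: derive_cst.
- near=> y; apply: f0; near: y.
  have : continuous (fun y : R => `|y|) by move=> y; exact: norm_continuous.
  by move=> /(_ x) /(@cvgr_gt _ _ _ _ _ _) /(_ _ rx).
Unshelve. all: by end_near. Qed.

Lemma derive1n_supp f r j : (forall x, r < `|x| -> f x = 0) ->
  forall x, r < `|x| -> f^`(j)%classic x = 0.
Proof.
by elim: j f => [//|j IH] f f0; rewrite derive1Sn; apply: IH; exact: derive1_supp.
Qed.

Lemma Ck_bounded_supp k f : Ck k f -> (forall x, 1 < `|x| -> f x = 0) ->
  exists M, forall j, (j <= k)%N -> forall x, `|f^`(j)%classic x| <= M.
Proof.
move=> fk f0.
have [M HM] : exists M : 'I_k.+1 -> R, forall (j : 'I_k.+1) x, `|f^`(j)%classic x| <= M j.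
  suff /choice[M HM] : forall j : 'I_k.+1, exists M, forall x, `|f^`(j)%classic x| <= M.
    by exists M.
  move=> j.
  have cj : continuous f^`(j)%classic.
    by apply: (@Ck_continuous (k - j)); apply: Ck_derive1n => //; rewrite -ltnS.
  have [|c _ Hc] := @EVT_max R (fun x => `|f^`(j)%classic x|) (-1) 1 ltac:(lra).
    apply: continuous_subspaceT => x; apply: cvg_norm; exact: cj.
  exists `|f^`(j)%classic c| => x.
  have [x1|x1] := leP `|x| 1; first by apply: Hc; rewrite in_itv/= -ler_norml.
  by rewrite (derive1n_supp j f0) ?normr0.
exists (\big[Num.max/0]_j M j) => j jk x.
apply: le_trans (HM (Ordinal (jk : (j < k.+1)%N)) x) _.
exact: (le_bigmax _ M).
Qed.

(** One copy of [phi], rescaled to width [rho], per pair (centre, height) of [l]. The common factor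
    [a] absorbs the powers of 1/rho, so that derivatives have the same form. *)
Definition bumps (a : R) (phi : R -> R) (rho : R) (l : seq (R * R)) (x : R) : R :=
  \sum_(q <- l) a * q.2 * phi (rho^-1 * x + - (rho^-1 * q.1)).

Lemma bumps_derive1 (a : R) (phi : R -> R) rho l : (forall x, derivable phi x 1) ->
  forall x, is_derive x (1 : R) (bumps a phi rho l) (bumps (a / rho) phi^`()%classic rho l x).
Proof.
move=> dphi x; elim: l => [|q l IH].
  rewrite /bumps big_nil (_ : (fun _ => _) = fun=> 0); first exact: is_derive_cst.
  by apply/funext => y; rewrite big_nil.
rewrite /bumps big_cons (_ : (fun _ => _) = fun y =>
  a * q.2 * phi (rho^-1 * y + - (rho^-1 * q.1)) + bumps a phi rho l y); last first.
  by apply/funext => y; rewrite big_cons.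
apply: is_deriveD.
have D : is_derive x (1 : R) (fun y : R => rho^-1 * y + - (rho^-1 * q.1)) rho^-1.
  by apply: is_derive_eq; rewrite subr0 /GRing.scale/= mulr1.
have := is_deriveZ (a * q.2) (is_derive1_comp (is_derive_derive1 dphi _) D).
by congr is_derive; rewrite /GRing.scale/=; ring.
Qed.

Lemma bumps_derive1n k phi rho l : Ck k phi -> forall a, Ck k (bumps a phi rho l) /\
  forall j, (j <= k)%N -> forall x,
    (bumps a phi rho l)^`(j)%classic x = bumps (a / rho ^+ j) phi^`(j)%classic rho l x.
Proof.
elim: k phi => [|k IH] phi.
  move=> cphi a; split; last first.
    by move=> [|//] _ x; rewrite expr0 divr1.
  move=> x; rewrite /bumps; elim: l => [|q l IHl].
    by rewrite (_ : (fun _ => _) = fun=> 0); [exact: cvg_cst|apply/funext => y; rewrite big_nil].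
  rewrite (_ : (fun _ => _) = fun y =>
    a * q.2 * phi (rho^-1 * y + - (rho^-1 * q.1)) + bumps a phi rho l y); last first.
    by apply/funext => y; rewrite big_cons.
  apply: cvgD => //; apply: cvgM; first exact: cvg_cst.
  exact: (Ck_comp (k := 0) cphi (Ck_affine 0 _ _)).
move=> [dphi kphi] a.
have E a' : (bumps a' phi rho l)^`()%classic = bumps (a' / rho) phi^`()%classic rho l.
  by apply/funext => x; have [_] := bumps_derive1 a' rho l dphi x; rewrite derive1E.
split; first by split => [x|]; [case: (bumps_derive1 a rho l dphi x)|rewrite E; have [] := IH _ kphi (a / rho)].
move=> [|j] jk x; first by rewrite expr0 divr1.
by rewrite !derive1Sn E (IH _ kphi _).2// exprS invfM mulrA.
Qed.

Lemma bumps_near a phi rho l x q : 0 < rho -> uniq l -> q \in l ->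
  (forall y, 1 < `|y| -> phi y = 0) ->
  (forall q', q' \in l -> q' != q -> 2 * rho < `|q'.1 - q.1|) ->
  `|x - q.1| <= rho -> bumps a phi rho l x = a * q.2 * phi (rho^-1 * x + - (rho^-1 * q.1)).
Proof.
move=> rho0 ul ql phi0 sep xq; rewrite /bumps (bigD1_seq q)//= big_seq_cond big1 ?addr0//.
move=> q' /andP[q'l q'q]; rewrite phi0 ?mulr0//.
rewrite -mulrBr normrM normfV (gtr0_norm rho0) ltr_pdivlMl// mulr1.
have := sep _ q'l q'q; have := ler_normD (x - q.1) (q'.1 - x).
by rewrite (_ : x - q.1 + _ = q'.1 - q.1); [rewrite (distrC q'.1 x); lra|ring].
Qed.

Lemma bumps_far a phi rho l x : 0 < rho -> (forall y, 1 < `|y| -> phi y = 0) ->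
  (forall q, q \in l -> rho < `|x - q.1|) -> bumps a phi rho l x = 0.
Proof.
move=> rho0 phi0 H; rewrite /bumps big_seq big1// => q ql; rewrite phi0 ?mulr0//.
by rewrite -mulrBr normrM normfV (gtr0_norm rho0) ltr_pdivlMl// mulr1 H.
Qed.

(* The constant M bounds the derivatives of the plateau function; it depends
   neither on the number of prescribed values nor on rho. *)
Definition interpolation_constant (k : nat) (M : R) : Prop :=
  0 <= M /\ forall (l : seq (R * R)) rho V, 0 < rho ->
  (forall q q', q \in l -> q' \in l -> q = q' \/ 2 * rho < `|q'.1 - q.1|) ->
  (forall q, q \in l -> `|q.2| <= V) -> 0 <= V ->
  exists h : R -> R, [/\ Ck k h,
    forall q x, q \in l -> `|x - q.1| <= rho / 2 -> h x = q.2,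
    forall x, (forall q, q \in l -> rho < `|x - q.1|) -> h x = 0 &
    forall j, (j <= k)%N -> forall x, `|h^`(j)%classic x| <= V * M / rho ^+ j].

(** The centres are more than 2 rho apart, so at most one bump is nonzero at any point and the
    derivative bounds do not add up. *)
Lemma smooth_interpolation k : exists M, interpolation_constant k M.
Proof.
have [phi [kphi phi1 phi0']] := exists_plateau k.
have phi0 x : 1 < `|x| -> phi x = 0 by move=> /ltW; exact: phi0'.
have [M HM] := Ck_bounded_supp kphi phi0.
have M0 : 0 <= M by apply: le_trans (HM 0%N isT 0).
(* The list may repeat an entry, whose bumps would add up; duplicates are removed. *)
exists M; split => // l' rho V rho0 sep' lV' V0; pose l := undup l'.
have ul : uniq l by exact: undup_uniq.
have sep q q' : q \in l -> q' \in l -> q' != q -> 2 * rho < `|q'.1 - q.1|.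
  rewrite !mem_undup => ql q'l; have [->|//] := sep' _ _ ql q'l.
  by rewrite eqxx.
have lV q : q \in l -> `|q.2| <= V by rewrite mem_undup; exact: lV'.
have [kb db] := bumps_derive1n rho l kphi 1.
exists (bumps 1 phi rho l); split => //.
- move=> q x; rewrite -mem_undup => ql xq.
  rewrite (@bumps_near _ _ _ _ _ q)//; last 2 first.
  + by move=> q' q'l; exact: sep.
  + by apply: le_trans xq _; rewrite ler_pdivrMr//; lra.
  rewrite phi1 ?mulr1 ?mul1r// -mulrBr normrM normfV (gtr0_norm rho0).
  by rewrite ler_pdivrMl// mulrC mulrC.
- move=> x H; apply: bumps_far => // q; rewrite mem_undup; exact: H.
move=> j jk x; rewrite db//.
have phij0 := derive1n_supp j phi0.
have [[q ql xq]|nq] := pselect (exists2 q, q \in l & `|x - q.1| <= rho).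
  rewrite (@bumps_near _ _ _ _ _ q)//; last by move=> q' q'l; exact: sep.
  rewrite !normrM normr1 mul1r normfV normrX (gtr0_norm rho0) [leRHS]mulrC -mulrA.
  apply: ler_wpM2l; first by rewrite invr_ge0 exprn_ge0// ltW.
  by apply: ler_pM => //; [exact: lV|exact: HM].
rewrite bumps_far ?normr0 ?mulr_ge0 ?invr_ge0 ?exprn_ge0 ?(ltW rho0)//.
by move=> q ql; rewrite ltNge; apply/negP => xq; apply: nq; exists q.
Qed.

End FiniteSmoothness.

(** * Compatibility of data vanishing near the end points *)

Section Compatibility.
Context {R : realType}.

Definition flat_at {V : normedModType R} (z : R) (f : R -> V) : Prop :=
  exists2 e, 0 < e & forall y, I01 y -> `|y - z| < e -> f y = 0.

Section Flat.
Context {V : normedModType R}.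
Implicit Types (f g : R -> V) (z : R).

(** Both values of [toC f] vanish near z: the restriction of f, and the default 0. *)
Lemma toC_flat k z f : flat_at z f -> flat_at z (toC k f).
Proof.
move=> [e e0 fe]; exists e => // y Iy ye.
rewrite /toC -[Cfun _]/(val _) val_insubd; case: ifP => // _.
by rewrite mem_set// fe.
Qed.

Lemma derive_in_flat z f : flat_at z f -> flat_at z (derive_in I01 f).
Proof.
move=> [e e0 fe]; exists e => // y Iy ye.
have FF := within_I01_proper Iy.
rewrite /derive_in.
suff : h^-1 *: (f (h + y) - f y) @[h --> within [set h | I01 (h + y)] (0 : R)^'] --> (0 : V).
  exact: cvg_lim.
apply: (@cvg_trans _ ((fun=> 0) @ within [set h | I01 (h + y)] (0 : R)^')); last exact: cvg_cst.
apply: near_eq_cvg.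
have : \forall h \near (0 : R)^', `|h + y - z| < e.
  apply: cvg_within; exists (e - `|y - z|) => /=; first by rewrite subr_gt0.
  move=> h /=; rewrite sub0r normrN ltrBrDr => he.
  apply: le_lt_trans he; rewrite -addrA; exact: ler_normD.
move=> Hn; have Hw : \forall h \near within [set h | I01 (h + y)] (0 : R)^', `|h + y - z| < e.
  exact: cvg_within.
have HI : \forall h \near within [set h | I01 (h + y)] (0 : R)^', I01 (h + y) by exact: withinT.
near=> h; rewrite (fe y)// (fe (h + y)) ?subrr ?scaler0//.
  by near: h.
by near: h.
Unshelve. all: by end_near. Qed.

Lemma Cspace_flat_lin k z (a : R) (f g : Cspace k V) :
  flat_at z f -> flat_at z g -> flat_at z (a *: f + g).
Proof.
move=> [e e0 fe] [d d0 gd]; exists (Num.min e d); first by rewrite lt_min e0.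
move=> y Iy; rewrite lt_min => /andP[ye yd].
by rewrite -[LHS]/(a *: f y + g y) fe// gd// scaler0 addr0.
Qed.

End Flat.

(* 'd is the choice of a linear map, which falls back to 0. *)
Lemma diff0_or_differentiable {V W : normedModType R} (f : V -> W) x :
  differentiable f x \/ forall v, 'd f x v = 0.
Proof.
pose P := fun df : {linear V -> W} => continuous df /\ forall y,
  f y = f (lim (nbhs x)) + df (y - lim (nbhs x)) +o_(y \near x) (y - lim (nbhs x)).
have [exP|nP] := pselect (exists df, P df).
  by left; apply/diffP; exact: (getPex exP).
have E : get P = point by apply: xgetPN => df Pdf; apply: nP; exists df.
by right => v; rewrite /diff -[get _]/(get P) E.
Qed.

Section Dpow.
Context {n : nat}.
Local Notation V := 'cV[R]_n.
Variables (F : V -> 'M[R]_n) (H : Cspace 0 V -> Cspace 0 V) (z : R).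
Hypothesis Iz : I01 z.
Hypothesis Hz : forall u : Cspace 0 V, flat_at z u -> H u z = 0.

(** Functions vanishing near z form a linear space, stable under the spatial derivative and the
    product by F(u). By induction all difference quotients of D^(k-1) H along this space vanish at
    z, hence so does their limit. Where D^(k-1) H is not differentiable, ['d] is 0. *)
Lemma Dpow_flat k (u : Cspace k V) : flat_at z u -> Dpow F H u z = 0.
Proof.
elim: k u => [|k IH] u fu; first exact: Hz.
rewrite /=; set U := toC k u; set h := toC k _.
have fU : flat_at z U by exact: toC_flat.
have fh : flat_at z h.
  apply: toC_flat; have [e e0 ue] := derive_in_flat fu.
  by exists e => // y Iy ye; rewrite ue// mulmx0.
have [dD|->//] := diff0_or_differentiable (@Dpow R n F H k) U.
rewrite -deriveE//; set D := 'D_h _ _.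
have cD : r^-1 *: (Dpow F H (r *: h + U) - Dpow F H U) @[r --> (0 : R)^'] --> D.
  exact: diff_derivable.
apply/eqP; rewrite -normr_le0; apply/ler_addgt0Pr => e e0; rewrite add0r.
move/cvgrPdist_le : cD => /(_ _ e0) /(@filter_ex _ _ _)[r re].
apply: le_trans re.
(* Evaluation at z is bounded by the sup norm, so |D z| is at most the distance from [D] to a
   quotient that vanishes at z. *)
set g := r^-1 *: _.
have g0 : g z = 0.
  rewrite -[LHS]/(r^-1 *: (Dpow F H (r *: h + U) z - Dpow F H U z)).
  by rewrite !IH ?subrr ?scaler0//; exact: Cspace_flat_lin.
have -> : D z = (D - g) z by rewrite -[RHS]/(D z - g z) g0 subr0.
exact: (Cnorm_ge (Cfun_class (D - g)) (leqnn 0) Iz).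
Qed.

End Dpow.

Lemma compatible_flat {n m} (F : 'cV[R]_n -> 'M[R]_n) (G : 'cV[R]_n -> 'cV[R]_n)
    (u0 : Cspace m 'cV[R]_n) : G 0 = 0 ->
  flat_at 0 u0 -> flat_at 1 u0 -> compatible F G u0.
Proof.
move=> G0 f0 f1 k km.
have I0 : (I01 : set R) 0 by rewrite /I01/= in_itv/= lexx ler01.
have I1 : (I01 : set R) 1 by rewrite /I01/= in_itv/= lexx ler01.
have K z (u : Cspace 0 'cV[R]_n) : I01 z -> flat_at z u -> u z = 0.
  by move=> Iz [e e0]; apply; rewrite ?subrr ?normr0.
rewrite (@Dpow_flat _ F id 0 I0 (fun u => K 0 u I0)) ?Dpow_flat//; last exact: toC_flat.
  move=> u [e e0 ue]; apply: K => //; apply: toC_flat.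
  by exists e => // y Iy ye; rewrite /= ue.
exact: toC_flat.
Qed.

End Compatibility.

(** * Initial data of class C^m built from two scalar profiles *)

Section InitialData.
Context {R : realType}.

Section Smooth01.
Context {V : normedModType R}.

Lemma derive_in_is_derive (f : R -> V) x l : I01 x -> is_derive x (1 : R) f l ->
  derivable_in I01 f x /\ derive_in I01 f x = l.
Proof.
move=> Ix [df dl]; have FF := within_I01_proper Ix.
have H : h^-1 *: (f (h + x) - f x) @[h --> within [set h | I01 (h + x)] (0 : R)^'] --> l.
  apply: (@cvg_trans _ ((fun h : R => h^-1 *: (f (h + x) - f x)) @ (0 : R)^')).
    exact: cvg_app (@cvg_within _ _ _ _).
  rewrite -dl; move: df; rewrite /derivable /derive.
  rewrite (_ : (fun h : R => h^-1 *: (f (h + x) - f x)) =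
    (fun h : R => h^-1 *: ((f \o shift x) (h *: (1 : R)) - f x)))//.
  by apply/funext => h; rewrite /= /GRing.scale/= mulr1.
by split; [apply/cvg_ex; exists l; exact: H|exact: cvg_lim H].
Qed.

(** [ds] lists the successive derivatives on the whole line; at points of [0, 1] the relative
    derivatives are their restrictions. *)
Lemma class_C_in_seq m (ds : nat -> R -> V) :
  (forall j, (j < m)%N -> forall x, is_derive x (1 : R) (ds j) (ds j.+1 x)) ->
  continuous (ds m) ->
  class_C_in I01 m (ds 0%N) /\
  forall j, (j <= m)%N -> forall x, I01 x -> derive_in_n I01 j (ds 0%N) x = ds j x.
Proof.
move=> dsS cds.
have E j : (j <= m)%N -> forall x, I01 x -> derive_in_n I01 j (ds 0%N) x = ds j x.
  elim: j => [//|j IH] jm x Ix /=.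
  rewrite (derive_in_eq (IH (ltnW jm)))//.
  by have [] := derive_in_is_derive Ix (dsS _ jm x).
have cj j : (j <= m)%N -> continuous (ds j).
  rewrite leq_eqVlt => /orP[/eqP -> //|jm] x.
  by apply: differentiable_continuous; apply/derivable1_diffP; case: (dsS _ jm x).
split => //; split => j jm.
  have /subspace_eq_continuous : {in (I01 : set R), ds j =1 derive_in_n I01 j (ds 0%N)}.
    by move=> x /set_mem Ix; rewrite E.
  by apply; apply: continuous_subspaceT; exact: cj.
move=> x Ix; apply: (@derivable_in_eq _ _ (ds j)) => //.
  by move=> y Iy; rewrite E// ltnW.
by have [] := derive_in_is_derive Ix (dsS _ jm x).
Qed.

End Smooth01.

Context {p : nat}.
Local Notation V := 'cV[R]_(p.+2).

Definition vec2 (f : bool -> R -> R) (x : R) : V :=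
  f false x *: delta_mx (active false) 0 + f true x *: delta_mx (active true) 0.

Lemma vec2_comp f x b : vec2 f x (active b) 0 = f b x.
Proof. by rewrite !mxE; case: b; rewrite /= ?mulr0 ?mulr1 ?addr0 ?add0r. Qed.

Lemma vec2_norm f x B : 0 <= B -> (forall b, `|f b x| <= B) -> `|vec2 f x| <= B.
Proof.
move=> B0 fB; rewrite [`|_|]mx_normrE; apply: bigmax_le => //= -[i j] _.
rewrite /= (ord1 j).
have [->|->|[l ->]] := ordP i; rewrite ?vec2_comp//.
by rewrite !mxE/= !mulr0 addr0 normr0.
Qed.

Lemma is_derive_scalel (W : normedModType R) (g : R -> R) (w : W) (x dg : R) :
  is_derive x (1 : R) g dg -> is_derive x (1 : R) (fun y => g y *: w) (dg *: w).
Proof.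
move=> [dgx gE].
have dg' : differentiable g x by exact/derivable1_diffP.
have dgw : differentiable (fun y => g y *: w) x by exact: differentiableZl.
apply: DeriveDef; first exact: diff_derivable.
by rewrite deriveE// diffZl// -deriveE// gE.
Qed.

Lemma Ck_initial_data m (f : bool -> R -> R) : (forall b, Ck m (f b)) ->
  [/\ forall x b, I01 x -> toC m (vec2 f) x (active b) 0 = f b x,
      forall z, (forall b, flat_at z (f b)) -> flat_at z (toC m (vec2 f)) &
      forall B, 0 <= B -> (forall b j, (j <= m)%N -> forall x, `|(f b)^`(j)%classic x| <= B) ->
        `|toC m (vec2 f)| <= B].
Proof.
move=> fm; pose ds j := vec2 (fun b => (f b)^`(j)%classic).
have [|x|Cf fE] := @class_C_in_seq V m ds.
- move=> j jm x; apply: is_deriveD; apply: is_derive_scalel; rewrite derive1nS;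
  by apply: is_derive_derive1; exact: Ck_derivable1n (fm _).
- have cd b : continuous (fun x => (f b)^`(m)%classic x *: delta_mx (active b) 0 : V).
    move=> y; apply: cvgZr_tmp.
    by apply: (@Ck_continuous _ (m - m)); exact: Ck_derive1n.
  by apply: (@cvgD _ V); exact: cd.
split.
- by move=> x b Ix; rewrite toCE// vec2_comp.
- move=> z fz; apply: toC_flat.
  have [e0 e00 H0] := fz false; have [e1 e10 H1] := fz true.
  exists (Num.min e0 e1); first by rewrite lt_min e00.
  move=> y Iy; rewrite lt_min => /andP[y0 y1].
  by rewrite /vec2 H0// H1// !scale0r addr0.
move=> B B0 fB; rewrite Cspace_normE; apply: Cnorm_le => // j jm x Ix.
have E : forall y, I01 y -> toC m (vec2 f) y = ds 0%N y by move=> y Iy; rewrite toCE.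
rewrite (_ : derive_in_n I01 j (toC m (vec2 f)) x = ds j x).
  by apply: vec2_norm => // b; exact: fB.
rewrite -fE//; elim: j {jm} x Ix => [|j IH] x Ix; first exact: E.
exact: derive_in_eq.
Qed.

End InitialData.

(** * Characteristics *)

Section Characteristics.
Context {R : realType}.

Definition strip : set (R * R) := Rplus `*` I01.

Lemma strip_continuous_dist {V : normedModType R} (f : R * R -> V) :
  {within strip, continuous f} ->
  forall t x, Rplus t -> I01 x -> forall e, 0 < e ->
  exists2 d, 0 < d & forall t' x', Rplus t' -> I01 x' ->
    `|t' - t| < d -> `|x' - x| < d -> `|f (t', x') - f (t, x)| < e.
Proof.
move=> /subspace_continuousP cf t x Pt Ix e e0.
have := cf (t, x) (conj Pt Ix) => /cvgrPdist_lt /(_ _ e0).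
rewrite /within /= => -[[A B] [/= /nbhs_ballP[a /= a0 Aa] /nbhs_ballP[b /= b0 Bb]] AB].
exists (Num.min a b); first by rewrite lt_min a0.
move=> t' x' Pt' Ix'; rewrite !lt_min => /andP[ta _] /andP[_ xb].
rewrite distrC; apply: (AB (t', x')) => /=; last by split.
by split; [apply: Aa|apply: Bb]; rewrite /ball/= distrC.
Qed.

Lemma within_continuous_dist {V : normedModType R} (A : set R) (f : R -> V) :
  (forall x, A x -> forall e, 0 < e -> exists2 d, 0 < d &
    forall y, A y -> `|y - x| < d -> `|f y - f x| < e) -> {within A, continuous f}.
Proof.
move=> H; apply/subspace_continuousP => x Ax; apply/cvgrPdist_lt => e e0.
have [d d0 Hd] := H _ Ax _ e0.
exists d => //= y /=; rewrite distrC => yd Ay; rewrite distrC; exact: Hd.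
Qed.

Definition between (a b y : R) := (a <= y <= b) || (b <= y <= a).

Lemma between_dist a b y : between a b y -> `|y - a| <= `|b - a|.
Proof.
by case/orP => /andP[? ?]; [rewrite !ger0_norm|rewrite !ler0_norm]; lra.
Qed.

Lemma MVT_between (f df : R -> R) (a b : R) :
  (forall y, between a b y -> is_derive y (1 : R) f (df y)) ->
  exists2 c, between a b c & f b - f a = df c * (b - a).
Proof.
have le_case (a' b' : R) : a' <= b' ->
    (forall y, a' <= y <= b' -> is_derive y (1 : R) f (df y)) ->
    exists2 c, a' <= c <= b' & f b' - f a' = df c * (b' - a').
  move=> ab Dab.
  have Doo y : y \in `]a', b'[ -> is_derive y (1 : R) f (df y).
    by move=> /subset_itv_oo_cc; rewrite in_itv; exact: Dab.
  have cf : {within `[a', b'], continuous f}.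
    by apply: derivable_within_continuous => y; rewrite in_itv => /Dab; case.
  by have [c] := MVT_segment ab Doo cf; rewrite in_itv/=; exists c.
move=> D; have [ab|/ltW ba] := leP a b.
  have [y yab|c cE E] := le_case a b ab; first by apply: D; rewrite /between yab.
  by exists c => //; rewrite /between cE.
have [y yab|c cE E] := le_case b a ba; first by apply: D; rewrite /between yab orbT.
exists c; first by rewrite /between cE orbT.
by rewrite -opprB E; ring.
Qed.

Lemma is_derive_quotP (f : R -> R) (x l : R) :
  is_derive x (1 : R) f l <-> (fun h : R => h^-1 * (f (x + h) - f x)) @ (0 : R)^' --> l.
Proof.
rewrite (_ : (fun h : R => h^-1 * (f (x + h) - f x)) =
  (fun h : R => h^-1 *: ((f \o shift x) (h *: (1 : R)) - f x))); last first.
  by apply/funext => h; rewrite /GRing.scale/= mulr1 [h + x]addrC.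
split => [[df <-]|H]; first exact: df.
by apply: DeriveDef; [apply/cvg_ex; exists l; exact: H|exact: cvg_lim H].
Qed.

Variables (z zt zx : R -> R -> R).
Hypothesis zc : {within strip, continuous (fun q => z q.1 q.2)}.
Hypothesis ztc : {within strip, continuous (fun q => zt q.1 q.2)}.
Hypothesis ztE : forall t x : R, 0 < t -> 0 < x < 1 -> is_derive t (1 : R) (z ^~ x) (zt t x).
Hypothesis zxE : forall t x : R, 0 < t -> 0 < x < 1 -> is_derive x (1 : R) (z t) (zx t x).

(** The increment is split into a step in t at the shifted abscissa, handled by the mean value
    theorem and the joint continuity of [zt], and a step in x at fixed t, where the partial
    derivative suffices. *)
Lemma is_derive_along (t0 x0 r s : R) : 0 < t0 + s -> 0 < x0 + r * s < 1 ->
  is_derive s (1 : R) (fun s => z (t0 + s) (x0 + r * s))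
    (zt (t0 + s) (x0 + r * s) + r * zx (t0 + s) (x0 + r * s)).
Proof.
move=> t_gt0 /andP[x_gt0 x_lt1]; set t := t0 + s; set x := x0 + r * s.
have Ix : I01 x by rewrite /I01/= in_itv/= !ltW.
pose q2 (h : R) := h^-1 * (z t (x + r * h) - z t x).
have q2E : q2 h @[h --> (0 : R)^'] --> r * zx t x.
  have D0 : is_derive (0 : R) (1 : R) (fun h => z t (r * h + x)) (zx t x * r).
    apply: is_derive1_comp.
      by rewrite mulr0 add0r; apply: zxE => //; rewrite x_gt0.
    by apply: is_derive_eq; rewrite addr0 /GRing.scale/= mulr1.
  rewrite mulrC (_ : q2 = fun h => h^-1 * (z t (r * (0 + h) + x) - z t (r * 0 + x))).
    exact/is_derive_quotP.
  by apply/funext => h; rewrite /q2 mulr0 !add0r [_ + x]addrC.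
pose q1 (h : R) := h^-1 * (z (t + h) (x + r * h) - z t (x + r * h)).
have q1E : q1 h @[h --> (0 : R)^'] --> zt t x.
  apply/cvgrPdist_le => e e0.
  have Pt : Rplus t by rewrite /Rplus/= in_itv/= andbT ltW.
  have [d d0 Hd] := strip_continuous_dist ztc Pt Ix e0.
  pose D := Num.min d (Num.min x (1 - x)).
  have r1 : 0 < `|r| + 1 by rewrite ltr_wpDl.
  have D0 : 0 < D / (`|r| + 1) by rewrite divr_gt0// !lt_min d0 x_gt0 subr_gt0.
  near=> h.
  have h0 : h != 0 by near: h; exact: nbhs_dnbhs_neq.
  have hd : `|h| < d by near: h; exact: dnbhs0_lt.
  have ht : `|h| < t by near: h; exact: dnbhs0_lt.
  have hr : `|h| < D / (`|r| + 1) by near: h; exact: dnbhs0_lt.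
  have rh : `|r * h| < D.
    rewrite normrM; apply: (@le_lt_trans _ _ ((`|r| + 1) * `|h|)).
      by rewrite ler_wpM2r// lerDl.
    by rewrite mulrC -ltr_pdivlMr.
  move: rh; rewrite !lt_min => /and3P[rd rx rx1].
  have x'01 : 0 < x + r * h < 1.
    move: rx rx1; rewrite !ltr_norml => /andP[? ?] /andP[? ?]; apply/andP; split; lra.
  have Dz y : between t (t + h) y -> is_derive y (1 : R) (z ^~ (x + r * h)) (zt y (x + r * h)).
    move=> /between_dist; rewrite [t + h]addrC addrK => yE; apply: ztE => //.
    have := le_lt_trans yE ht; rewrite ltr_norml => /andP[? _]; lra.
  have [c /between_dist cE E] := MVT_between Dz.
  rewrite [t + h]addrC addrK in cE E.
  rewrite /q1 [t + h]addrC E mulrCA mulVf// mulr1 distrC; apply: ltW.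
  apply: Hd => //.
  - have := le_lt_trans cE ht; rewrite ltr_norml => /andP[? _].
    by rewrite /Rplus/= in_itv/= andbT; lra.
  - by move: x'01; rewrite /I01/= in_itv/= => /andP[/ltW -> /ltW ->].
  - exact: le_lt_trans cE hd.
  - by rewrite (_ : _ - _ = r * h)//; rewrite [LHS]addrC addKr.
have H : (fun h : R => h^-1 * (z (t0 + (s + h)) (x0 + r * (s + h)) - z t x))
    @ (0 : R)^' --> zt t x + r * zx t x.
  rewrite (_ : (fun h : R => _) = (fun h => q1 h + q2 h)); first exact: cvgD.
  apply/funext => h; rewrite /q1 /q2 -mulrDr; congr (_ * _).
  have -> : t0 + (s + h) = t + h by rewrite addrA.
  have -> : x0 + r * (s + h) = x + r * h by rewrite mulrDr addrA.
  by ring.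
by apply/is_derive_quotP.
Unshelve. all: by end_near. Qed.

Variables (l beta L : R).
Hypothesis beta01 : 0 <= beta <= 1.
Hypothesis pde : forall t x : R, 0 < t -> 0 < x < 1 ->
  zt t x + (l - beta * z t x ^+ 2) * zx t x = 0.
Hypothesis z1 : forall t x, Rplus t -> I01 x -> `|z t x| <= 1.
Hypothesis zxL : forall t x : R, 0 < t -> 0 < x < 1 -> `|zx t x| <= L.

(* z - z(t0, x0) satisfies a linear differential equation along the line: Gronwall. *)
Lemma constant_along (t0 x0 s : R) : Rplus t0 -> I01 x0 ->
  let r := l - beta * z t0 x0 ^+ 2 in
  0 < r -> 0 <= s -> x0 + r * s <= 1 -> z (t0 + s) (x0 + r * s) = z t0 x0.
Proof.
rewrite /Rplus /I01 /= !in_itv/= andbT => t00 /andP[x00 x01].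
set c := z t0 x0; set r := _ - _ => r0 s0 xs.
have L0 : 0 <= L by apply: le_trans (zxL (t := 1) (x := 2^-1) _ _); rewrite ?normr_ge0//; lra.
pose f s := z (t0 + s) (x0 + r * s).
have f0 : f 0 = c by rewrite /f mulr0 !addr0.
(* The rate 4 L dominates the factor 2 beta (f + c) z_x, since beta <= 1, |f + c| <= 2 and |z_x| <=
   L. *)
pose psi s := (f s - c) ^+ 2 * expR (- (4 * L) * s).
have inside u : 0 <= u <= s -> Rplus (t0 + u) /\ I01 (x0 + r * u).
  move=> /andP[u0 us]; rewrite /Rplus /I01/= !in_itv/= andbT addr_ge0//; split => //.
  rewrite addr_ge0 ?mulr_ge0 ?(ltW r0)//=; apply: le_trans xs.
  by rewrite lerD2l ler_pM2l.
have f1 u : 0 <= u <= s -> `|f u| <= 1 by move=> /inside[? ?]; exact: z1.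
(* The slope is frozen at r = l - beta c^2, so the equation gives f' = z_t + r z_x = beta (f^2 -
   c^2) z_x, which contains the factor f - c. *)
have df u : 0 < u < s -> is_derive u (1 : R) f
    (beta * (f u + c) * (f u - c) * zx (t0 + u) (x0 + r * u)).
  move=> /andP[u0 us].
  have tu : 0 < t0 + u by rewrite ltr_wpDl.
  have xu : 0 < x0 + r * u < 1.
    rewrite ltr_wpDl ?mulr_gt0//=; apply: lt_le_trans xs.
    by rewrite ltrD2l ltr_pM2l.
  apply: is_derive_eq; first exact: is_derive_along.
  have := pde tu xu; rewrite -/(f u) /r => E.
  by rewrite -[LHS]subr0 -E; ring.
(* The line may start or end on the boundary of the strip, where only continuity is at hand. *)
have cf : {within `[0, s], continuous f}.
  apply: within_continuous_dist => u; rewrite /= in_itv/= => us e e0.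
  have [Pu Iu] := inside _ us.
  have [d d0 Hd] := strip_continuous_dist zc Pu Iu e0.
  exists (Num.min d (d / r)); first by rewrite lt_min d0 divr_gt0.
  move=> v; rewrite /= in_itv/= => vs; rewrite lt_min => /andP[uv uvr].
  have [Pv Iv] := inside _ vs.
  apply: Hd => //; first by rewrite opprD addrACA subrr add0r.
  rewrite opprD addrACA subrr add0r -mulrBr normrM gtr0_norm//.
  by rewrite -ltr_pdivlMl// mulrC.
have dpsi u : 0 < u < s -> is_derive u (1 : R) psi
   ((2 * beta * (f u + c) * zx (t0 + u) (x0 + r * u) - 4 * L) * psi u).
  move=> us; have dfu := df _ us.
  have dfc : is_derive u (1 : R) (fun s => f s - c)
      (beta * (f u + c) * (f u - c) * zx (t0 + u) (x0 + r * u)).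
    by apply: is_derive_eq; rewrite subr0.
  have de : is_derive u (1 : R) (fun s => expR (- (4 * L) * s)) (expR (- (4 * L) * u) * - (4 * L)).
    apply: (@is_derive1_comp _ expR (fun s => - (4 * L) * s)).
    by apply: is_derive_eq; rewrite /GRing.scale/= mulr1.
  have := is_deriveM (is_deriveM dfc dfc) de.
  by congr is_derive; rewrite /psi /GRing.scale/= !mulrfctE /=; ring.
have psi0 : psi s <= psi 0.
  apply: (@ler0_derive1_le_cc R psi 0 s) => //.
  - by move=> u; rewrite in_itv/= => /dpsi[].
  - move=> u; rewrite in_itv/= => us; rewrite derive1E; have [_ ->] := dpsi _ us.
    have us' : 0 <= u <= s by case/andP: us => /ltW -> /ltW ->.
    apply: mulr_le0_ge0; last by rewrite mulr_ge0 ?sqr_ge0 ?expR_ge0.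
    rewrite subr_le0; apply: le_trans (ler_norm _) _; rewrite !normrM.
    have fc : `|f u + c| <= 2.
      apply: le_trans (ler_normD _ _) _.
      have := f1 _ us'; have := f1 0; rewrite f0 lexx s0 => /(_ isT); lra.
    have zL : `|zx (t0 + u) (x0 + r * u)| <= L.
      have [? _] := inside _ us'; apply: zxL.
        by case/andP: us => u0 _; rewrite ltr_wpDl.
      case/andP: us => u0 us; rewrite ltr_wpDl ?mulr_gt0//=.
      by apply: lt_le_trans xs; rewrite ltrD2l ltr_pM2l.
    case/andP: beta01 => b0 b1.
    rewrite (ger0_norm (_ : 0 <= 2))// (ger0_norm b0).
    rewrite (_ : 4 * L = 2 * 1 * 2 * L); last by ring.
    by rewrite !ler_pM// ?mulr_ge0// ler_pM2l.
  - move=> u; apply: (@cvgM _ _ (nbhs (u : subspace `[0, s])) _ (fun s => (f s - c) ^+ 2)).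
      have cfc : (fun s => f s - c) @ nbhs (u : subspace `[0, s]) --> f u - c.
        by apply: cvgB; [exact: cf|exact: cvg_cst].
      exact: (cvgM cfc cfc).
    apply: (continuous_subspaceT (f := fun s : R => expR (- (4 * L) * s))) => v.
    apply: (@continuous_comp _ _ _ (fun s => - (4 * L) * s) expR); last exact: continuous_expR.
    by apply: cvgM; [exact: cvg_cst|exact: cvg_id].
  - by rewrite in_itv/= s0 lexx.
  - by rewrite in_itv/= s0 lexx.
move: psi0; rewrite /psi f0 subrr expr0n mul0r => psi0.
have : (f s - c) ^+ 2 <= 0 by move: psi0; rewrite pmulr_lle0// expR_gt0.
by rewrite real_exprn_even_le0 ?num_real//= subr_eq0 => /eqP.
Qed.

End Characteristics.

(** * Components and time slices of a solution *)

Section Solutions.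
Context {R : realType}.

Section Components.
Context {n : nat}.
Local Notation V := 'cV[R]_n.

Lemma normcV_coord (v : V) i : `|v i 0| <= `|v|.
Proof. by rewrite [leRHS]mx_normrE; exact: (le_bigmax _ (fun ij => `|v ij.1 ij.2|) (i, 0)). Qed.

Lemma derivable_in_coord (A : set R) (f : R -> V) x i :
  (exists2 d, 0 < d & forall h, `|h| < d -> A (h + x)) -> derivable_in A f x ->
  is_derive x (1 : R) (fun y => f y i 0) (derive_in A f x i 0).
Proof.
move=> [d d0 Ad] df; apply/is_derive_quotP.
have sub : ((0 : R)^') --> within [set h | A (h + x)] (0 : R)^'.
  move=> P HP; have {}HP : \forall h \near (0 : R)^', A (h + x) -> P h := HP.
  have dd : \forall h \near (0 : R)^', `|h| < d by exact: dnbhs0_lt.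
  apply: (@filterS2 _ _ _ _ _ _ _ HP dd) => h Hh hd; apply: Hh; exact: Ad.
have H : (fun h : R => h^-1 *: (f (h + x) - f x)) @ (0 : R)^' --> derive_in A f x.
  by apply: cvg_trans df; exact: cvg_app sub.
have Hc := cvg_comp _ _ H (@coord_continuous R n 1 i 0 (derive_in A f x)).
rewrite (_ : (fun h : R => _) =
  (fun v : V => v i 0) \o (fun h : R => h^-1 *: (f (h + x) - f x))); first exact: Hc.
by apply/funext => h; rewrite /= !mxE [h + x]addrC.
Unshelve. all: by end_near. Qed.

Lemma strip_continuous_coord (u : R -> R -> V) i :
  {within strip, continuous (fun q => u q.1 q.2)} ->
  {within (strip : set (R * R)), continuous (fun q => u q.1 q.2 i 0)}.
Proof.
move=> cu q.
have := cvg_comp _ _ (cu q) (@coord_continuous R n 1 i 0 (u q.1 q.2)).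
exact.
Qed.

End Components.

Section Slices.
Context {V : normedModType R}.

Lemma class_C_strip_within m (u : R -> R -> V) : class_C_strip m u ->
  {within strip, continuous (fun q => u q.1 q.2)}.
Proof. by case: m => [|m] []. Qed.

Lemma class_C_strip_dx m (u : R -> R -> V) j : (j <= m)%N -> class_C_strip m u ->
  class_C_strip (m - j) (iter j dx u).
Proof.
elim: j m u => [|j IH] m u; first by rewrite subn0.
by case: m => [//|m] jm [_ [_ _ udx]]; rewrite iterSr subSS; exact: IH.
Qed.

Lemma iter_dx (u : R -> R -> V) j t : iter j dx u t = derive_in_n I01 j (u t).
Proof. by elim: j => [//|j IH] /=; rewrite -IH. Qed.

Lemma class_C_strip_slice m (u : R -> R -> V) t : Rplus t -> class_C_strip m u ->
  class_C_in I01 m (u t).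
Proof.
move=> Pt um; split => j jm.
  rewrite -iter_dx; apply: within_continuous_dist => x Ix e e0.
  have [d d0 Hd] := strip_continuous_dist
    (class_C_strip_within (class_C_strip_dx jm um)) Pt Ix e0.
  by exists d => // y Iy yx; apply: Hd => //; rewrite subrr normr0.
move=> x Ix; rewrite -iter_dx.
have := class_C_strip_dx (ltnW jm) um; rewrite -subnSK// => -[_ [H _ _]].
by have [] := H _ _ Pt Ix.
Qed.

End Slices.

Context {p : nat}.
Local Notation V := 'cV[R]_(p.+2).

(** Both active speeds have the form l - beta c^2, with (l, beta) equal to (1, 1) or (sqrt 2, 0).
    The gradient bound is asked for t > 0 only, as the decay estimate starts there. *)
Lemma solution_constant_along m (G : V -> V) (u0 : Cspace m V) (u : R -> R -> V) (L : R) :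
  m <> 0%N -> is_solution Fsys G u0 u ->
  (forall t x, Rplus t -> I01 x -> `|u t x| <= 1) ->
  (forall t x, 0 < t -> I01 x -> `|dx u t x| <= L) ->
  forall b t0 x0 s, Rplus t0 -> I01 x0 ->
  let r := speed b (u t0 x0 (active b) 0) in
  0 < r -> 0 <= s -> x0 + r * s <= 1 ->
  u (t0 + s) (x0 + r * s) (active b) 0 = u t0 x0 (active b) 0.
Proof.
case: m u0 => [//|m] u0 _ [[cu [dtx Cdt Cdx]] pde _ _] u1 uL b t0 x0 s Pt0 Ix0.
have I01P (x : R) : 0 < x < 1 -> I01 x by move=> /andP[? ?]; rewrite /I01/= in_itv/= !ltW.
have RplusP (t : R) : 0 < t -> Rplus t by move=> ?; rewrite /Rplus/= in_itv/= andbT ltW.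
pose l : R := if b then Num.sqrt 2 else 1.
pose beta : R := if b then 0 else 1.
have speedE c : speed b c = l - beta * c ^+ 2.
  by rewrite /speed /l /beta; case: ifP; rewrite ?mul0r ?subr0 ?mul1r.
rewrite speedE => r r0 s0 xs.
apply: (@constant_along R (fun t x => u t x (active b) 0) (fun t x => dt u t x (active b) 0)
  (fun t x => dx u t x (active b) 0) _ _ _ _ l beta L) => //.
- exact: strip_continuous_coord.
- by apply: strip_continuous_coord; exact: (@class_C_strip_within _ m _ Cdt).
- move=> t x t0' /I01P Ix; have [dtu _] := dtx _ _ (RplusP _ t0') Ix.
  apply: derivable_in_coord dtu; exists t => // h.
  by rewrite ltr_norml => /andP[? _]; rewrite /Rplus/= in_itv/= andbT; lra.
- move=> t x t0' x01; have [_ dxu] := dtx _ _ (RplusP _ t0') (I01P _ x01).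
  apply: derivable_in_coord dxu; exists (Num.min x (1 - x)).
    by case/andP: x01 => ? ?; rewrite lt_min subr_gt0; apply/andP.
  move=> h; rewrite lt_min !ltr_norml => /andP[/andP[? _] /andP[_ ?]].
  by rewrite /I01/= in_itv/=; apply/andP; split; lra.
- by rewrite /beta; case: ifP; rewrite ?lexx ler01.
- move=> t x t0' x01; have := pde _ _ (RplusP _ t0') (I01P _ x01).
  move=> /(congr1 (fun v : V => v (active b) 0)) /=.
  by rewrite mxE Fsys_mul speedE [RHS]mxE.
- by move=> t x Pt Ix; apply: le_trans (normcV_coord _ _) _; exact: u1.
- by move=> t x t0' x01; apply: le_trans (normcV_coord _ _) _; apply: uL => //; exact: I01P.
Qed.

End Solutions.

(** * Growth of a C^m function next to a plateau *)

Section Taylor.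
Context {R : realType}.

(** The derivatives below order m vanish at x'; each application of the mean value theorem from x'
    contributes a factor d. *)
Lemma taylor_of_flat m (D : nat -> R -> R) (M d x1 x2 x' : R) :
  (forall j, (j < m)%N -> forall x : R, 0 < x < 1 -> is_derive x (1 : R) (D j) (D j.+1 x)) ->
  (forall x : R, 0 < x < 1 -> `|D m x| <= M) ->
  0 <= x1 -> x2 <= 1 -> x1 < x' < x2 ->
  (forall x, x1 < x < x2 -> D 0%N x = 0) ->
  forall y : R, 0 < y < 1 -> `|y - x'| <= d -> `|D 0%N y| <= M * d ^+ m.
Proof.
move=> + + x10 x21 x'12; elim: m D => [|m IH] D DS DM D0 y y01 yd.
  by rewrite expr0 mulr1; exact: DM.
have in01 x : x1 < x < x2 -> 0 < x < 1.
  by move=> /andP[a b]; rewrite (le_lt_trans x10 a) (lt_le_trans b x21).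
have D1 x : x1 < x < x2 -> D 1%N x = 0.
  move=> x12; have [_ <-] := DS 0%N isT x (in01 _ x12).
  rewrite (@near_eq_derive _ _ _ (D 0%N) (fun=> 0)) ?derive_cst//.
  near=> z; apply: D0; apply/andP; split; near: z.
    by apply: lt_nbhsr; case/andP: x12.
  by apply: lt_nbhsl; case/andP: x12.
have x'01 := in01 _ x'12.
have bet z : between x' y z -> 0 < z < 1.
  by case/orP => /andP[a b]; case/andP: x'01 => ? ?; case/andP: y01 => ? ?; apply/andP; split; lra.
have [z zb E] := @MVT_between R (D 0%N) (D 1%N) x' y (fun z zb => DS 0%N isT z (bet z zb)).
move: E; rewrite (D0 x')// subr0 => ->.
have zd : `|z - x'| <= d by apply: le_trans yd; exact: between_dist.
rewrite normrM exprSr mulrA; apply: ler_pM => //.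
exact: (IH (fun j => D j.+1) (fun j jm => DS j.+1 jm) DM D1 z (bet _ zb) zd).
Unshelve. all: by end_near. Qed.

(** Serves as a lower bound on the m-th derivative: a gap E eta^m within distance eta of a plateau
    forces M >= E. *)
Lemma slice_gap {n} m (f : R -> 'cV[R]_n) i (M d c x1 x2 x' y : R) : m <> 0%N ->
  class_C_in I01 m f -> (forall x, I01 x -> `|derive_in_n I01 m f x| <= M) ->
  0 <= x1 -> x2 <= 1 -> x1 < x' < x2 ->
  (forall x, x1 < x < x2 -> f x i 0 = c) ->
  0 < y < 1 -> `|y - x'| <= d -> `|f y i 0 - c| <= M * d ^+ m.
Proof.
move=> m0 [_ fm] fM x10 x21 x'12 fc y01 yd.
pose D j x := derive_in_n I01 j f x i 0 - (if j == 0%N then c else 0).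
have I01P (x : R) : 0 < x < 1 -> I01 x by move=> /andP[? ?]; rewrite /I01/= in_itv/= !ltW.
apply: (@taylor_of_flat m D M d x1 x2 x') => //.
- move=> j jm x x01; rewrite /D subr0.
  have dj : is_derive x (1 : R) (fun x => derive_in_n I01 j f x i 0) (derive_in_n I01 j.+1 f x i 0).
    apply: derivable_in_coord (fm _ jm _ (I01P _ x01)).
    exists (Num.min x (1 - x)).
      by case/andP: x01 => ? ?; rewrite lt_min subr_gt0; apply/andP.
    move=> h; rewrite lt_min !ltr_norml => /andP[/andP[? _] /andP[_ ?]].
    by rewrite /I01/= in_itv/=; apply/andP; split; lra.
  by apply: is_derive_eq; rewrite subr0.
- move=> x x01; rewrite /D ifN ?subr0; last exact/eqP.
  by apply: le_trans (normcV_coord _ _) _; apply: fM; exact: I01P.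
- by move=> x x12; rewrite /D/= fc// subrr.
Qed.

End Taylor.

(** * Reflections *)

Section Words.
Context {R : realType}.
Local Notation r2 := (Num.sqrt 2 : R).

Lemma sqrt2_sqr : r2 ^+ 2 = 2. Proof. by rewrite sqr_sqrtr. Qed.

Lemma sqrt2_bounds : 4/3 < r2 < 3/2.
Proof.
have r0 : 0 <= r2 by exact: sqrtr_ge0.
have := sqrt2_sqr; rewrite expr2 => E.
by apply/andP; split; rewrite ltNge; apply/negP => H; nra.
Qed.

(** The exponent of 2 would be odd on the left and even on the right. *)
Lemma sqrt2_int (x y : int) : (2 * x ^+ 2 = y ^+ 2)%R -> x = 0.
Proof.
move=> /(congr1 absz); rewrite abszM !abszX /= => E.
apply/eqP; rewrite -absz_eq0; apply/negPn/negP => x0.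
have x0' : (0 < `|x|)%N by rewrite lt0n.
have y0 : (0 < `|y|)%N.
  by rewrite lt0n; apply/negP => /eqP y0; move/eqP: E; rewrite y0 muln_eq0 expn_eq0/= (negPf x0).
move/(congr1 (logn 2)): E; rewrite lognM ?expn_gt0 ?x0'// !lognX /=.
by move=> /(congr1 odd); rewrite oddD !oddM.
Qed.

(** The delays at rest are 1 and 1/sqrt 2; their independence lets a time determine how often each
    letter occurs. *)
Lemma sqrt2_comb_int (x y : int) : x%:~R + y%:~R / r2 = 0 -> x = 0 /\ y = 0.
Proof.
have [r43 r32] := andP sqrt2_bounds; have r0 : r2 != 0 by rewrite gt_eqF; lra.
move=> E; have E2 : x%:~R * r2 = - y%:~R.
  by apply/eqP; rewrite -subr_eq0 opprK -(mulfK r0 y%:~R) -mulrAC -mulrDl E mul0r.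
have x0 : x = 0.
  apply: (@sqrt2_int x y); apply/eqP; rewrite -(eqr_int R) rmorphM/= !rmorphXn/=.
  by rewrite -(sqrrN y%:~R) -E2 exprMn sqrt2_sqr mulrC.
split => //; apply/eqP; rewrite -(intr_eq0 R); move: E2; rewrite x0 mul0r.
by move/eqP; rewrite eq_sym oppr_eq0.
Qed.

(* (1, sqrt 2 - 1) is an eigenvector of K for 1/sqrt 2, so that these values are
   propagated from level l + 1 to level l by a reflection. *)
Definition amp (delta : R) (b : bool) (l : nat) : R :=
  r2 ^+ l * delta * (if b then r2 - 1 else 1).

Lemma amp_false delta l :
  amp delta false l = 2^-1 * (amp delta false l.+1 + amp delta true l.+1).
Proof.
have -> : 2^-1 * (amp delta false l.+1 + amp delta true l.+1) =
    2^-1 * r2 ^+ 2 * (r2 ^+ l * delta) by rewrite /amp exprS; ring.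
by rewrite sqrt2_sqr /amp; field.
Qed.

Lemma amp_true delta l :
  amp delta true l = 2^-1 * (amp delta false l.+1 - amp delta true l.+1).
Proof.
have -> : 2^-1 * (amp delta false l.+1 - amp delta true l.+1) =
    (r2 - 2^-1 * r2 ^+ 2) * (r2 ^+ l * delta) by rewrite /amp exprS; field.
by rewrite sqrt2_sqr /amp; field.
Qed.

Lemma amp_scale delta b l : amp delta b l = delta * amp 1 b l.
Proof. by rewrite /amp; ring. Qed.

(* A word lists the components followed back in time from the boundary time T,
   its head being the last one followed.  For delta = 0 the delays are those of
   the linearised system. *)
Fixpoint node_time (T delta : R) (s : seq bool) : R :=
  if s is b :: s' then node_time T delta s' - (speed b (amp delta b (size s)))^-1 else T.

Lemma speed_bounds b (c : R) : `|c| <= 2^-1 -> 3/4 <= speed b c <= 3/2.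
Proof.
move=> c2; have [? ?] := andP sqrt2_bounds.
have : c ^+ 2 <= 4^-1.
  by rewrite -real_normK ?num_real//; have := normr_ge0 c; rewrite expr2; nra.
have := sqr_ge0 c; rewrite /speed; case: b => ? ?; lra.
Qed.

Lemma speed_dist b (c c' : R) : `|c| <= 2^-1 -> `|c'| <= 2^-1 ->
  `|speed b c' - speed b c| <= `|c' - c|.
Proof.
move=> c2 c'2; rewrite /speed; case: b; first by rewrite subrr normr0.
rewrite (_ : _ - _ = (c' - c) * - (c' + c)); last by ring.
rewrite normrM normrN ler_piMr// (le_trans (ler_normD _ _))//; lra.
Qed.

Lemma delay_dist b (c c' : R) : `|c| <= 2^-1 -> `|c'| <= 2^-1 ->
  `|(speed b c')^-1 - (speed b c)^-1| <= 2 * `|c' - c|.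
Proof.
move=> c2 c'2; have := speed_dist b c2 c'2.
have /andP[s1 _] := speed_bounds b c2; have /andP[s1' _] := speed_bounds b c'2.
set x := speed b c in s1 *; set y := speed b c' in s1' * => xy.
have x0 : x != 0 by rewrite gt_eqF; lra.
have y0 : y != 0 by rewrite gt_eqF; lra.
rewrite (_ : _ - _ = (x - y) / (x * y)); last by field; rewrite ?x0 ?y0.
rewrite normrM normfV ler_pdivrMr ?normr_gt0 ?mulf_neq0//.
(* Both speeds are at least 3/4 and 9/16 > 1/2: hence the constant 2. *)
have xy2 : 2^-1 <= `|x * y| by rewrite ger0_norm; nra.
by rewrite distrC; apply: le_trans xy _; have := normr_ge0 (c' - c); nra.
Qed.

Lemma amp_le delta b l N : 0 <= delta -> (l <= N)%N -> `|amp delta b l| <= r2 ^+ N * delta.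
Proof.
move=> d0 lN; have [? ?] := andP sqrt2_bounds.
rewrite /amp normrM; apply: (@le_trans _ _ (`|r2 ^+ l * delta| * 1)).
  by apply: ler_wpM2l => //; case: ifP => _; rewrite ger0_norm; lra.
rewrite mulr1 ger0_norm ?mulr_ge0 ?exprn_ge0 ?sqrtr_ge0// ler_wpM2r//.
by apply: ler_weXn2l => //; lra.
Qed.

Lemma node_time0 T s : node_time T 0 s = T - (count_mem false s)%:R - (count_mem true s)%:R / r2.
Proof.
elim: s => [|b s IH] /=; first by rewrite mul0r !subr0.
rewrite IH /amp mulr0 mul0r /speed; case: b => /=.
  by rewrite !natrD mulrDl; ring.
by rewrite expr0n subr0 invr1 !natrD; ring.
Qed.

Lemma size_counts (s : seq bool) : size s = (count_mem false s + count_mem true s)%N.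
Proof. by elim: s => [//|[] s /= ->]; rewrite add0n add1n ?addnS ?addSn. Qed.

Lemma node_time0_eq T s s' : node_time T 0 s = node_time T 0 s' ->
  count_mem false s = count_mem false s' /\ count_mem true s = count_mem true s'.
Proof.
rewrite !node_time0 => E.
have [] := @sqrt2_comb_int ((count_mem false s)%:Z - (count_mem false s')%:Z)
  ((count_mem true s)%:Z - (count_mem true s')%:Z).
  by rewrite !rmorphB/= mulrBl -!pmulrn; lra.
by move=> /eqP; rewrite subr_eq0 => /eqP[->] /eqP; rewrite subr_eq0 => /eqP[->].
Qed.

(** A zero would make the odd integer 1 + 2 (k - a) vanish, where a counts the letters [false]. This
    is the reason for the half in T: no characteristic of the tree starts at the corner (0, 0). *)
Lemma node_time0_neq0 k s : node_time (k%:R + 2^-1) 0 s != 0.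
Proof.
apply/eqP; rewrite node_time0 => E.
have [] := @sqrt2_comb_int (1 + 2 * (k%:Z - (count_mem false s)%:Z))
  (- 2 * (count_mem true s)%:Z).
  rewrite !(rmorphD, rmorphM, rmorphN, rmorphB)/= -!pmulrn.
  by rewrite -[RHS](mulr0 2) -E; field; have [? ?] := andP sqrt2_bounds; rewrite gt_eqF; lra.
move=> /(congr1 (fun x : int => (x %% 2)%Z)).
by rewrite addrC mulrC modzMDl.
Qed.

(** Each delay at rest is at least 2/3, so fewer than 3/2 T letters fit; the tree is finite, of
    depth below 2 k + 2. *)
Lemma node_time_size_lt k s : 0 < node_time (k%:R + 2^-1) 0 s -> (size s < 2 * k + 2)%N.
Proof.
rewrite node_time0 size_counts => H; rewrite -(ltr_nat R) natrD [(2 * k + 2)%:R]natrD natrM.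
have [? ?] := andP sqrt2_bounds.
have r0 : 0 < r2 by lra.
have : (count_mem true s)%:R * (2 / 3) <= (count_mem true s)%:R / r2 :> R.
  rewrite ler_wpM2l// -(invrK (2 / 3)) lef_pV2 ?posrE// invf_div; lra.
have := ler0n R (count_mem false s); have := ler0n R (count_mem true s); have := ler0n R k.
lra.
Qed.

(** The delay added by the base state at level l to the delay 1 at rest of the first component; the
    second component has a constant speed. *)
Definition excess (delta : R) (l : nat) : R := (speed false (amp delta false l))^-1 - 1.

Fixpoint dev (delta : R) (s : seq bool) : R :=
  if s is b :: s' then dev delta s' + (if b then 0 else excess delta (size s)) else 0.

Lemma node_time_dev T delta s : node_time T delta s = node_time T 0 s - dev delta s.
Proof.
elim: s => [|b s IH] /=; first by rewrite subr0.
rewrite IH /excess; case: b; first by rewrite /speed; ring.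
by rewrite [amp 0 _ _]/amp mulr0 mul0r [speed false 0]/speed expr0n subr0 invr1; ring.
Qed.

Lemma amp_ge0 delta b l : 0 <= delta -> 0 <= amp delta b l.
Proof.
move=> d0; have [? ?] := andP sqrt2_bounds.
by rewrite /amp !mulr_ge0 ?exprn_ge0 ?sqrtr_ge0//; case: ifP => _; lra.
Qed.

Lemma amp_false_mono delta l N : 0 <= delta -> (l <= N)%N -> amp delta false l <= amp delta false N.
Proof.
move=> d0 lN; have [? ?] := andP sqrt2_bounds.
by rewrite /amp !mulr1 ler_wpM2r// ler_weXn2l//; lra.
Qed.

Lemma excess_sqr delta l : (amp delta false l.+1) ^+ 2 = 2 * (amp delta false l) ^+ 2.
Proof.
have -> : amp delta false l.+1 = r2 * amp delta false l by rewrite /amp exprS; ring.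
by rewrite exprMn sqrt2_sqr.
Qed.

Lemma excessE delta l : amp delta false l <= 2^-1 -> 0 <= delta ->
  excess delta l = (amp delta false l) ^+ 2 / (1 - (amp delta false l) ^+ 2).
Proof.
move=> a2 /(amp_ge0 false l) a0; rewrite /excess /speed; set a := amp _ _ _ in a2 a0 *.
have an0 : 1 - a ^+ 2 != 0 by rewrite expr2 gt_eqF//; nra.
by field.
Qed.

(** The squared amplitude doubles exactly, and x / (1 - x) grows faster than linearly. *)
Lemma excess_double delta l : amp delta false l.+1 <= 2^-1 -> 0 <= delta ->
  2 * excess delta l <= excess delta l.+1.
Proof.
move=> a2 d0; have a2' := le_trans (amp_false_mono d0 (leqnSn l)) a2.
rewrite !excessE// excess_sqr.
have := excess_sqr delta l; have a0 := amp_ge0 false l.+1 d0.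
have := sqr_ge0 (amp delta false l); set a := amp _ _ l ^+ 2 => a0' aS.
have a4 : 2 * a <= 4^-1 by rewrite -aS expr2; nra.
rewrite mulrA ler_wpM2l//; first lra.
by rewrite lef_pV2 ?posrE; lra.
Qed.

Lemma excess_gt0 delta l : amp delta false l <= 2^-1 -> 0 < delta -> 0 < excess delta l.
Proof.
move=> a2 d0; rewrite excessE ?(ltW d0)//.
have [? ?] := andP sqrt2_bounds.
have a0 : 0 < amp delta false l by rewrite /amp mulr1 mulr_gt0// exprn_gt0//; lra.
by rewrite divr_gt0 ?exprn_gt0// subr_gt0 expr2; nra.
Qed.

(** As in a geometric sum of ratio at least 2, all excesses up to a level add up to less than the
    next one. *)
Lemma dev_bounds delta s : amp delta false (size s).+1 <= 2^-1 -> 0 < delta ->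
  0 <= dev delta s < excess delta (size s).+1.
Proof.
move=> + d0; elim: s => [|b s IH] a2; first by rewrite lexx excess_gt0.
have a2' := le_trans (amp_false_mono (ltW d0) (leqnSn _)) a2.
have /andP[IH1 IH2] := IH a2'; have := excess_double a2 (ltW d0).
have := excess_gt0 a2' d0; rewrite /= => e0 e2.
by case: ifP => _; apply/andP; split; lra.
Qed.

(* The excess doubles at each level, as a binary digit. *)
Lemma dev_inj delta s s' : amp delta false (size s).+1 <= 2^-1 -> 0 < delta ->
  size s = size s' -> dev delta s = dev delta s' -> s = s'.
Proof.
move=> + d0; elim: s s' => [|b s IH] [|b' s'] //= a2 [ss'].
have a2' := le_trans (amp_false_mono (ltW d0) (leqnSn _)) a2.
have /andP[B1 B2] := dev_bounds a2' d0.
have /andP[B1' B2'] : 0 <= dev delta s' < excess delta (size s').+1.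
  by apply: dev_bounds => //; rewrite -ss'.
rewrite ss' in B2 *.
case: b b' {a2} => [] [] /= E; [|exfalso; lra|exfalso; lra|];
  by congr (_ :: _); apply: IH => //; lra.
Qed.

(** Equal times at rest give equal letter counts, hence equal lengths; the deviations then
    distinguish the words. *)
Lemma node_time_inj T delta s s' : amp delta false (size s).+1 <= 2^-1 -> 0 < delta ->
  node_time T 0 s = node_time T 0 s' -> node_time T delta s = node_time T delta s' -> s = s'.
Proof.
move=> a2 d0 q0 q; have [c1 c2] := node_time0_eq q0.
apply: (@dev_inj delta) => //; first by rewrite !size_counts c1 c2.
by move: q; rewrite !(node_time_dev T delta) q0; lra.
Qed.

Lemma node_time_dist T delta s N : 0 <= delta -> (size s <= N)%N ->
  r2 ^+ N * delta <= 2^-1 ->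
  `|node_time T delta s - node_time T 0 s| <= N%:R * (2 * (r2 ^+ N * delta)).
Proof.
move=> d0 sN a2; apply: (@le_trans _ _ ((size s)%:R * (2 * (r2 ^+ N * delta)))); last first.
  rewrite ler_wpM2r ?ler_nat// !mulr_ge0 ?exprn_ge0 ?sqrtr_ge0//.
elim: s sN => [|b s IH] sN; first by rewrite /= subrr normr0 mul0r.
rewrite [X in _ <= X * _]/= -natr1 mulrDl mul1r.
have az : amp 0 b (size s).+1 = 0 by rewrite /amp mulr0 mul0r.
rewrite /= az (_ : _ - _ = (node_time T delta s - node_time T 0 s) -
  ((speed b (amp delta b (size s).+1))^-1 - (speed b 0)^-1)); last by ring.
apply: le_trans (ler_normB _ _) _; apply: lerD; first exact: IH (ltnW sN).
have aN := amp_le b d0 sN.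
apply: le_trans (delay_dist b _ _) _; rewrite ?normr0 ?invr_ge0 ?subr0//.
  exact: le_trans aN a2.
by rewrite ler_pM2l.
Qed.

(** The product of the signs of the entries of K along the word; only the entry ([true], [true]) is
    negative. The default of [head] is [false] because the component followed from T is the first
    one. *)
Fixpoint node_sign (s : seq bool) : R :=
  if s is b :: s' then (if b && head false s' then - node_sign s' else node_sign s') else 1.

Lemma node_sign_norm s : `|node_sign s| = 1.
Proof. by elim: s => [|b s IH] /=; [rewrite normr1|case: ifP; rewrite ?normrN]. Qed.

(* The characteristic of component b that reaches x = 1 at the time of the node s
   starts at t = 0, not at x = 0. *)
Definition leaf T b s := (0 < node_time T 0 s) && (node_time T 0 (b :: s) <= 0).

(** * Propagation from the leaves to the root of the tree of words *)

Section Tree.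
Variables (k : nat) (delta A eta d : R) (f v w : bool -> R -> R).
Local Notation T := (k%:R + 2^-1 : R).
Local Notation N := (2 * k + 2)%N.
Hypothesis A0 : 0 <= A.
Hypothesis small : forall b l, (l <= N)%N -> `|amp delta b l| + A <= 2^-1.
Hypothesis v_false : forall t, 0 <= t -> v false t = 2^-1 * (w false t + w true t).
Hypothesis v_true : forall t, 0 <= t -> v true t = 2^-1 * (w false t - w true t).
Hypothesis w_v : forall b t, 0 <= t -> `|v b t| <= 2^-1 ->
  w b (t + (speed b (v b t))^-1) = v b t.
Hypothesis w_f : forall b x, 0 <= x <= 1 -> `|f b x| <= 2^-1 ->
  w b ((1 - x) / speed b (f b x)) = f b x.
Hypothesis times : forall s, 0 < node_time T 0 s -> d <= node_time T delta s /\ eta <= node_time T delta s.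
Hypothesis dA : N%:R * (2 * A) <= d.
Hypothesis leaf_peak : forall b s t, leaf T b s -> `|t - node_time T delta s| <= d ->
  let c := amp delta b (size s).+1 + node_sign (b :: s) * A in
  0 <= 1 - t * speed b c <= 1 /\ f b (1 - t * speed b c) = c.
Hypothesis leaf_flat : forall b s t, leaf T b s ->
  node_time T delta s - eta <= t <= node_time T delta s - eta / 2 ->
  let c := amp delta b (size s).+1 in
  0 <= 1 - t * speed b c <= 1 /\ f b (1 - t * speed b c) = c.

Let w_of_f b c t : `|c| <= 2^-1 -> 0 <= 1 - t * speed b c <= 1 ->
  f b (1 - t * speed b c) = c -> w b t = c.
Proof.
move=> c2 x01 fc; have := @w_f b _ x01; rewrite fc => /(_ c2).
have /andP[s0 _] := speed_bounds b c2.
by rewrite opprD addrA subrr sub0r opprK mulfK// gt_eqF//; lra.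
Qed.

Let w_of_v b c t : `|c| <= 2^-1 -> 0 <= t - (speed b c)^-1 ->
  v b (t - (speed b c)^-1) = c -> w b t = c.
Proof. by move=> c2 t0 vc; have := @w_v b _ t0; rewrite vc subrK => /(_ c2). Qed.

(** Bumps alter a delay by at most 2 A, so the peak value is known on a window whose radius loses 2
    A at each reflection towards T. The signs match the rows of K: the two incoming deviations
    reinforce each other and their mean still has modulus A. *)
Lemma node_values s : 0 < node_time T 0 s ->
  (forall t, `|t - node_time T delta s| <= (size s)%:R * (2 * A) ->
     v (head false s) t = amp delta (head false s) (size s) + node_sign s * A) /\
  (forall t, node_time T delta s - eta <= t <= node_time T delta s - eta / 2 ->
     v (head false s) t = amp delta (head false s) (size s)).
Proof.
(* Induction towards longer words; a node at a positive time has fewer than N letters, so the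
   measure decreases. *)
have [j] := ubnP (N - size s)%N; elim: j s => [//|j IH] s sj s0.
have sN := node_time_size_lt s0.
have amp2 b : `|amp delta b (size s).+1| <= 2^-1.
  by apply: le_trans (small b sN); rewrite lerDl.
have c2 b : `|amp delta b (size s).+1 + node_sign (b :: s) * A| <= 2^-1.
  apply: le_trans (small b sN); apply: le_trans (ler_normD _ _) _.
  by rewrite lerD2l normrM node_sign_norm mul1r ger0_norm.
have nonneg b t : 0 < node_time T 0 (b :: s) -> `|t - node_time T delta (b :: s)| <= d -> 0 <= t.
  by move=> /times[+ _]; rewrite ler_norml => ? /andP[? _]; lra.
have [q1 q2] := times s0.
have sA : (size s)%:R * (2 * A) <= d.
  by apply: le_trans dA; rewrite ler_wpM2r ?mulr_ge0// ler_nat ltnW.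
have W1 b t : `|t - node_time T delta s| <= (size s)%:R * (2 * A) ->
    w b t = amp delta b (size s).+1 + node_sign (b :: s) * A.
  move=> ts; have [lb|bs0] := leP (node_time T 0 (b :: s)) 0.
    have lf : leaf T b s by rewrite /leaf s0.
    by have [? ?] := leaf_peak lf (le_trans ts sA); apply: w_of_f.
  have [IH1 _] := IH (b :: s) ltac:(by rewrite /= subnS; case: (N - size s)%N (subn_gt0 (size s) N) sj => [|n _]//; rewrite sN) bs0.
  have tb : `|t - (speed b (amp delta b (size s).+1 + node_sign (b :: s) * A))^-1 -
      node_time T delta (b :: s)| <= (size s).+1%:R * (2 * A).
    rewrite /= (_ : _ - _ = (t - node_time T delta s) -
      ((speed b (amp delta b (size s).+1 + node_sign (b :: s) * A))^-1 -
       (speed b (amp delta b (size s).+1))^-1)); last by rewrite /=; ring.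
    apply: le_trans (ler_normB _ _) _.
    rewrite (_ : (size s).+1%:R * _ = (size s)%:R * (2 * A) + 2 * A); last first.
      by rewrite -natr1; ring.
    apply: lerD => //.
    apply: le_trans (delay_dist b (amp2 b) (c2 b)) _.
    by rewrite addrC addKr normrM node_sign_norm mul1r ger0_norm.
  apply: w_of_v => //; last exact: IH1.
  apply: (nonneg b) => //; apply: le_trans tb _; apply: le_trans dA.
  by rewrite ler_wpM2r ?mulr_ge0// ler_nat.
(* On a plateau the values are those of the base state, so the delays are exactly those of
   [node_time] and the interval is carried over without loss. *)
have W2 b t : node_time T delta s - eta <= t <= node_time T delta s - eta / 2 ->
    w b t = amp delta b (size s).+1.
  move=> ts; have [lb|bs0] := leP (node_time T 0 (b :: s)) 0.
    have lf : leaf T b s by rewrite /leaf s0.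
    by have [? ?] := leaf_flat lf ts; apply: w_of_f.
  have [_ IH2] := IH (b :: s) ltac:(by rewrite /= subnS; case: (N - size s)%N (subn_gt0 (size s) N) sj => [|n _]//; rewrite sN) bs0.
  have tb : node_time T delta (b :: s) - eta <= t - (speed b (amp delta b (size s).+1))^-1
      <= node_time T delta (b :: s) - eta / 2.
    by move: ts => /= /andP[? ?]; apply/andP; split; lra.
  apply: w_of_v => //; last exact: IH2.
  have [_ ?] := times bs0; have /andP[? _] := tb; lra.
split => t ts.
  have t0 : 0 <= t.
    by have := le_trans ts sA; rewrite ler_norml => /andP[? _]; lra.
  case hs : (head false s); rewrite ?v_true ?v_false// !W1//= hs.
    by rewrite (amp_true delta (size s)); field.
  by rewrite (amp_false delta (size s)); field.
have t0 : 0 <= t by move/andP: ts => [? _]; lra.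
case hs : (head false s); rewrite ?v_true ?v_false// !W2//.
  by rewrite (amp_true delta (size s)).
by rewrite (amp_false delta (size s)).
Qed.

(** The window of the empty word has radius 0: it is reduced to the time T. *)
Lemma root_peak : v false T = delta + A.
Proof.
have [|H _] := @node_values [::]; first by rewrite /= ltr_wpDl.
by have := H T; rewrite /= subrr normr0 mul0r lexx => ->//; rewrite /amp expr0 !mul1r mulr1.
Qed.

Lemma root_flat t : T - eta <= t <= T - eta / 2 -> v false t = delta.
Proof.
have [|_ H] := @node_values [::]; first by rewrite /= ltr_wpDl.
by move=> /H; rewrite /= /amp expr0 mul1r mulr1.
Qed.

End Tree.

End Words.

(** * Initial data *)

Section Design.
Context {R : realType}.
Local Notation r2 := (Num.sqrt 2 : R).

Lemma finite_margin {I : eqType} (l : seq I) (F : I -> R) :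
  exists2 mu, 0 < mu & forall x, x \in l -> 0 < F x -> mu <= F x.
Proof.
elim: l => [|x l [mu mu0 H]]; first by exists 1.
have [Fx|Fx] := ltP 0 (F x).
  exists (Num.min mu (F x)) => [|y]; first by rewrite lt_min mu0.
  rewrite inE => /predU1P[->|yl] Fy; first by rewrite ge_min lexx orbT.
  by rewrite ge_min H.
exists mu => // y; rewrite inE => /predU1P[->|]; last exact: H.
by rewrite ltNge Fx.
Qed.

Fixpoint words_upto (n : nat) : seq (seq bool) :=
  if n is n'.+1 then
    [::] :: ([seq false :: s | s <- words_upto n'] ++ [seq true :: s | s <- words_upto n'])
  else [:: [::]].

Lemma mem_words_upto n s : (size s <= n)%N -> s \in words_upto n.
Proof.
elim: n s => [|n IH] [|b s] //= sn; rewrite inE mem_cat; apply/orP; right.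
by case: b; apply/orP; [right|left]; apply/map_f/IH.
Qed.

Section FixK.
Variable k : nat.
Local Notation T := (k%:R + 2^-1 : R).
Local Notation N := (2 * k + 2)%N.

Definition leaves (b : bool) : seq (seq bool) := [seq s <- words_upto N | leaf T b s].

Lemma mem_leaves b s : (s \in leaves b) = leaf T b s.
Proof.
rewrite mem_filter; case: (boolP (leaf T b s)) => //= /andP[s0 _].
by apply/mem_words_upto/ltnW; exact: (node_time_size_lt s0).
Qed.

(* The starting point at t = 0 of the characteristic of a leaf. *)
Definition leaf_pos (delta : R) (b : bool) (s : seq bool) : R :=
  1 - node_time T delta s * speed b (amp delta b (size s).+1).

Lemma amp0 b l : amp 0 b l = 0 :> R.
Proof. by rewrite /amp mulr0 mul0r. Qed.

Lemma speed0_gt0 b : 0 < speed b (0 : R).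
Proof.
have z2 : `|0 : R| <= 2^-1 by rewrite normr0; lra.
by have /andP[? _] := speed_bounds b z2; lra.
Qed.

(** Strictness at 0 is the absence of characteristics through the corner; it lets the data vanish
    near both end points. *)
Lemma leaf_pos0_in01 b s : leaf T b s -> 0 < leaf_pos 0 b s < 1.
Proof.
move=> /andP[s0 /= bs0]; have l0 := speed0_gt0 b.
rewrite /leaf_pos; rewrite amp0 in bs0 *.
have : node_time T 0 s - (speed b 0)^-1 != 0.
  by have := @node_time0_neq0 R k (b :: s); rewrite /= amp0.
move=> ne; have lt : node_time T 0 s - (speed b 0)^-1 < 0 by rewrite lt_neqAle ne.
rewrite subr_gt0 -ltr_pdivlMr// mul1r; rewrite subr_lt0 in lt; rewrite lt/=.
by rewrite ltrBlDr ltrDl mulr_gt0.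
Qed.

(** Words may share a position at rest, but then they have the same level, so one base profile can
    take the value required by each of them. *)
Lemma leaf_pos0_inj b s s' : leaf_pos 0 b s = leaf_pos 0 b s' ->
  size s = size s' /\ node_time T 0 s = node_time T 0 s'.
Proof.
rewrite /leaf_pos !amp0 => E.
have q : node_time T 0 s = node_time T 0 s'.
  have l0 := speed0_gt0 b; apply: (mulIf (lt0r_neq0 l0)); lra.
have [c1 c2] := node_time0_eq q.
by rewrite !size_counts c1 c2.
Qed.

(** All positions are those at rest, so [mu] is fixed before [delta]; the last clause leaves out
    words that share a position. *)
Definition margin (mu : R) : Prop :=
  (forall s, 0 < node_time T 0 s -> mu <= node_time T 0 s) /\
  forall b s, leaf T b s -> [/\ mu <= leaf_pos 0 b s, leaf_pos 0 b s <= 1 - mu &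
    forall s', leaf T b s' -> leaf_pos 0 b s <> leaf_pos 0 b s' ->
      mu <= `|leaf_pos 0 b s - leaf_pos 0 b s'|].

Lemma base_margin : exists2 mu, 0 < mu <= 1 & margin mu.
Proof.
have Hb b : exists2 mu, 0 < mu &
    forall s, leaf T b s -> [/\ mu <= leaf_pos 0 b s, leaf_pos 0 b s <= 1 - mu &
    forall s', leaf T b s' -> leaf_pos 0 b s <> leaf_pos 0 b s' ->
      mu <= `|leaf_pos 0 b s - leaf_pos 0 b s'|].
  have [m1 m10 H1] := finite_margin (leaves b) (leaf_pos 0 b).
  have [m2 m20 H2] := finite_margin (leaves b) (fun s => 1 - leaf_pos 0 b s).
  have [m3 m30 H3] := finite_margin [seq (s, s') | s <- leaves b, s' <- leaves b]
    (fun q => `|leaf_pos 0 b q.1 - leaf_pos 0 b q.2|).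
  exists (Num.min m1 (Num.min m2 m3)); first by rewrite !lt_min m10 m20.
  move=> s ls; have /andP[p0 p1] := leaf_pos0_in01 ls; split.
  - by rewrite ge_min H1// mem_leaves.
  - have : m2 <= 1 - leaf_pos 0 b s by apply: H2; rewrite ?mem_leaves// subr_gt0.
    by move=> h; rewrite lerBrDr addrC -lerBrDr !ge_min h orbT.
  - move=> s' ls' ne; rewrite !ge_min; apply/orP; right; apply/orP; right.
    apply: (H3 (s, s')); last by rewrite normr_gt0 subr_eq0; exact/eqP.
    by apply/allpairsP; exists (s, s'); rewrite !mem_leaves.
have [m0 m00 H0] := Hb false; have [m1 m10 H1] := Hb true.
have [m2 m20 H2] := finite_margin (words_upto N) (node_time T 0).
pose mu := Num.min (Num.min m0 m1) (Num.min m2 1).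
have le0 : mu <= m0 by rewrite !ge_min lexx.
have le1 : mu <= m1 by rewrite !ge_min lexx orbT.
have le2 : mu <= m2 by rewrite !ge_min lexx !orbT.
exists mu; first by rewrite !lt_min m00 m10 m20 ltr01/= !ge_min lexx !orbT.
split=> [s s0|b s ls].
  by apply: le_trans le2 _; apply: H2 => //; apply/mem_words_upto/ltnW; exact: (node_time_size_lt s0).
case: b ls => [/H1|/H0] [h1 h2 h3]; split.
- exact: le_trans h1.
- by apply: le_trans h2 _; rewrite lerD2l lerN2.
- by move=> s' ls' ne; apply: le_trans (h3 _ ls' ne).
- exact: le_trans h1.
- by apply: le_trans h2 _; rewrite lerD2l lerN2.
- by move=> s' ls' ne; apply: le_trans (h3 _ ls' ne).
Qed.

Lemma node_time0_le s : node_time T 0 s <= T.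
Proof.
elim: s => [//|b s IH] /=; apply: le_trans IH.
by rewrite amp0 gerBl invr_ge0 ltW// speed0_gt0.
Qed.

(** With P = sqrt 2^N delta, the time moves by at most 2 N P, at a speed of at most 3/2, and the
    speed changes by at most P over a time of at most T. *)
Lemma leaf_pos_dist delta b s : 0 <= delta -> r2 ^+ N * delta <= 2^-1 -> leaf T b s ->
  `|leaf_pos delta b s - leaf_pos 0 b s| <= (3 * N%:R + T) * (r2 ^+ N * delta).
Proof.
move=> d0 P2 /andP[s0 _]; have sN := node_time_size_lt s0.
have D := node_time_dist T d0 (ltnW sN) P2.
have aN := amp_le b d0 sN; have a2 := le_trans aN P2.
have z2 : `|0 : R| <= 2^-1 by rewrite normr0; lra.
have sd := speed_dist b z2 a2; rewrite subr0 in sd.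
have /andP[sb1 sb2] := speed_bounds b a2.
rewrite /leaf_pos amp0 (_ : _ - _ = - ((node_time T delta s - node_time T 0 s) *
  speed b (amp delta b (size s).+1) + node_time T 0 s *
  (speed b (amp delta b (size s).+1) - speed b 0))); last by ring.
rewrite normrN; apply: le_trans (ler_normD _ _) _; rewrite !normrM.
rewrite (gtr0_norm s0) (ger0_norm (_ : 0 <= speed b _)); last lra.
have q0T := node_time0_le s.
set P := _ * delta in D aN *.
have P0 : 0 <= P by apply: le_trans aN.
rewrite mulrDl; apply: lerD.
  apply: (@le_trans _ _ ((N%:R * (2 * P)) * (3 / 2))).
    by apply: ler_pM => //; lra.
  by rewrite le_eqVlt; apply/orP; left; apply/eqP; field.
by apply: ler_pM => //; [lra|exact: le_trans sd aN].
Qed.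

(** A profile for amplitude 1 at the positions at rest; the data use [delta] times it, so that [B]
    is known before [delta]. Its plateaus are wide enough to contain the perturbed positions. *)
Definition base_spec m mu B b (h : R -> R) : Prop := [/\ Ck m h,
    forall s x, leaf T b s -> `|x - leaf_pos 0 b s| <= mu / 8 -> h x = amp 1 b (size s).+1,
    forall x, (forall s, leaf T b s -> mu / 4 < `|x - leaf_pos 0 b s|) -> h x = 0 &
    forall j, (j <= m)%N -> forall x, `|h^`(j)%classic x| <= B].

Definition bump_spec m M E eta delta b (g : R -> R) : Prop := [/\ Ck m g,
    forall s x, leaf T b s -> `|x - leaf_pos delta b s| <= eta / 8 ->
      g x = node_sign (b :: s) * (E * eta ^+ m),
    forall x, (forall s, leaf T b s -> eta / 4 < `|x - leaf_pos delta b s|) -> g x = 0 &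
    forall j, (j <= m)%N -> forall x, `|g^`(j)%classic x| <= E * (4 ^+ m * M)].

Lemma base_profile m (M : R) mu : interpolation_constant m M -> 0 < mu -> margin mu ->
  exists2 B : R, 0 <= B & exists h : bool -> R -> R, forall b, base_spec m mu B b (h b).
Proof.
move=> [M0 interp] mu0 [_ Hmu]; pose rho := mu / 4; have rho0 : 0 < rho by rewrite divr_gt0.
pose P1 := r2 ^+ N; have P10 : 0 <= P1 by rewrite exprn_ge0// sqrtr_ge0.
have B0 j : 0 <= P1 * M / rho ^+ j by rewrite !mulr_ge0 ?invr_ge0 ?exprn_ge0 ?(ltW rho0).
exists (\big[Num.max/0]_(j < m.+1) (P1 * M / rho ^+ j)); first exact: bigmax_ge_id.
suff /choice[h hP] : forall b, exists h, base_spec m mu (\big[Num.max/0]_(j < m.+1) (P1 * M / rho ^+ j)) b h.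
  by exists h.
move=> b; pose l : seq (R * R) := [seq (leaf_pos 0 b s, amp 1 b (size s).+1) | s <- leaves b].
have sep q q' : q \in l -> q' \in l -> q = q' \/ 2 * rho < `|q'.1 - q.1|.
  move=> /mapP[s + ->] /mapP[s' + ->]; rewrite !mem_leaves => ls ls'.
  have [e|ne] := eqVneq (leaf_pos 0 b s) (leaf_pos 0 b s').
    by left; have [-> _] := leaf_pos0_inj e; rewrite e.
  right; have [_ _ H] := Hmu _ _ ls'; rewrite /=.
  apply: lt_le_trans (H _ ls _); last by move/esym/eqP; exact/negP.
  by rewrite /rho; lra.
have val q : q \in l -> `|q.2| <= P1.
  move=> /mapP[s]; rewrite mem_leaves => /andP[s0 _] -> /=.
  by apply: le_trans (amp_le b (ler01) (node_time_size_lt s0)) _; rewrite mulr1.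
have [h [h1 h2 h3 h4]] := interp l rho P1 rho0 sep val P10.
exists h; split => //.
- move=> s x ls xs; apply: (h2 (leaf_pos 0 b s, amp 1 b (size s).+1)).
    by apply/map_f; rewrite mem_leaves.
  by rewrite /= /rho (_ : mu / 4 / 2 = mu / 8)//; field.
- move=> x Hx; apply: h3 => q /mapP[s]; rewrite mem_leaves => ls ->; exact: Hx.
- move=> j jm x; apply: le_trans (h4 j jm x) _.
  exact: (le_bigmax _ (fun j : 'I_m.+1 => P1 * M / rho ^+ j) (Ordinal (jm : (j < m.+1)%N))).
Qed.

Lemma leaf_pos_near delta mu b s : 0 <= delta -> r2 ^+ N * delta <= 4^-1 ->
  (3 * N%:R + T) * (r2 ^+ N * delta) <= mu / 64 -> leaf T b s ->
  `|leaf_pos delta b s - leaf_pos 0 b s| <= mu / 64.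
Proof.
move=> d0 P4 Pmu ls; apply: le_trans (leaf_pos_dist d0 _ ls) Pmu.
by apply: le_trans P4 _; lra.
Qed.

(** Positions that differ at rest are [mu] apart and move by at most mu / 64 each. Words that share
    a position at rest have the same speed, so equal perturbed positions give equal perturbed
    times. *)
Lemma leaf_pos_inj delta mu b s s' : 0 < delta -> r2 ^+ N * delta <= 4^-1 ->
  (3 * N%:R + T) * (r2 ^+ N * delta) <= mu / 64 -> 0 < mu -> margin mu ->
  leaf T b s -> leaf T b s' -> leaf_pos delta b s = leaf_pos delta b s' -> s = s'.
Proof.
move=> d0 P4 Pmu mu0 [_ Hmu] ls ls' e.
have sN : (size s < N)%N by case/andP: ls => /node_time_size_lt.
have a2 b' : `|amp delta b' (size s).+1| <= 2^-1.
  by apply: le_trans (amp_le b' (ltW d0) sN) _; apply: le_trans P4 _; lra.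
have [e0|/eqP ne] := eqVneq (leaf_pos 0 b s) (leaf_pos 0 b s'); last first.
  exfalso; have [_ _ H] := Hmu _ _ ls; have dmu := H _ ls' ne.
  have d1 := leaf_pos_near (ltW d0) P4 Pmu ls; rewrite e distrC in d1.
  have d2 := leaf_pos_near (ltW d0) P4 Pmu ls'.
  have := ler_distD (leaf_pos delta b s') (leaf_pos 0 b s) (leaf_pos 0 b s').
  by clear -mu0 dmu d1 d2; lra.
have [es eq0] := leaf_pos0_inj e0.
apply: (@node_time_inj _ T delta) => //; first exact: le_trans (ler_norm _) (a2 _).
move: e; rewrite /leaf_pos -es => e.
have /andP[sp _] := speed_bounds b (a2 b).
have sp0 : speed b (amp delta b (size s).+1) != 0 by rewrite gt_eqF// (lt_le_trans _ sp).
by apply: (mulIf sp0); clear -e; lra.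
Qed.

Lemma leaf_pos_separated delta mu : 0 < delta -> r2 ^+ N * delta <= 4^-1 ->
  (3 * N%:R + T) * (r2 ^+ N * delta) <= mu / 64 -> 0 < mu -> margin mu ->
  exists2 kap, 0 < kap <= mu / 8 & forall b s s', leaf T b s -> leaf T b s' -> s <> s' ->
    kap <= `|leaf_pos delta b s - leaf_pos delta b s'|.
Proof.
move=> d0 P4 Pmu mu0 Hmu.
have Hb b : exists2 kap, 0 < kap & forall s s', leaf T b s -> leaf T b s' -> s <> s' ->
    kap <= `|leaf_pos delta b s - leaf_pos delta b s'|.
  have [m3 m30 H3] := finite_margin [seq (s, s') | s <- leaves b, s' <- leaves b]
    (fun q => `|leaf_pos delta b q.1 - leaf_pos delta b q.2|).
  exists m3 => // s s' ls ls' ne; apply: (H3 (s, s')).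
    by apply/allpairsP; exists (s, s'); rewrite !mem_leaves.
  rewrite normr_gt0 subr_eq0; apply/eqP => e; apply: ne.
  exact: leaf_pos_inj d0 P4 Pmu mu0 Hmu ls ls' e.
have [k0 k00 H0] := Hb false; have [k1 k10 H1] := Hb true.
(* The cap mu / 8 makes eta = kap / 4 at most mu / 32. *)
exists (Num.min (mu / 8) (Num.min k0 k1)).
  by rewrite !lt_min k00 k10 ge_min lexx divr_gt0.
by case=> s s' ls ls' ne; rewrite !ge_min ?(H0 _ _ ls ls' ne) ?(H1 _ _ ls ls' ne) !orbT.
Qed.

Lemma bump_profile m (M E : R) eta delta : interpolation_constant m M -> 0 <= E ->
  0 < eta <= 1 ->
  (forall b s s', leaf T b s -> leaf T b s' -> s <> s' ->
    4 * eta <= `|leaf_pos delta b s - leaf_pos delta b s'|) ->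
  exists g : bool -> R -> R, forall b, bump_spec m M E eta delta b (g b).
Proof.
move=> [M0 interp] E0 /andP[eta0 eta1] sep.
suff /choice[g gP] : forall b, exists g, bump_spec m M E eta delta b g by exists g.
move=> b.
set A := E * eta ^+ m.
have A0 : 0 <= A by rewrite mulr_ge0// exprn_ge0// ltW.
pose l : seq (R * R) := [seq (leaf_pos delta b s, node_sign (b :: s) * A) | s <- leaves b].
have eta4 : 0 < eta / 4 by rewrite divr_gt0.
have lsep q q' : q \in l -> q' \in l -> q = q' \/ 2 * (eta / 4) < `|q'.1 - q.1|.
  move=> /mapP[s + ->] /mapP[s' + ->]; rewrite !mem_leaves => ls ls'.
  have [->|/eqP ne] := eqVneq s s'; first by left.
  right; rewrite /=; apply: lt_le_trans (sep _ _ _ ls' ls _); last by move/esym.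
  by clear -eta0; lra.
have val q : q \in l -> `|q.2| <= A.
  move=> /mapP[s]; rewrite mem_leaves => _ ->.
  by rewrite -[(_, _).2]/(node_sign (b :: s) * A) normrM node_sign_norm mul1r ger0_norm.
have [g [g1 g2 g3 g4]] := interp l (eta / 4) A eta4 lsep val A0.
exists g; split => //.
- move=> s x ls xs; apply: (g2 (leaf_pos delta b s, node_sign (b :: s) * A)).
    by apply/map_f; rewrite mem_leaves.
  by rewrite /= (_ : eta / 4 / 2 = eta / 8)//; field.
- move=> x Hx; apply: g3 => q /mapP[s]; rewrite mem_leaves => ls ->; exact: Hx.
- move=> j jm x; apply: le_trans (g4 j jm x) _.
  rewrite ler_pdivrMr ?exprn_gt0// /A.
  (* The height E eta^m compensates the factor (4 / eta)^j for every j <= m; this bound depends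
     neither on eta nor on the number of words. *)
  have -> : eta ^+ m = 4 ^+ m * (eta / 4) ^+ m by rewrite -exprMn; congr (_ ^+ _); field.
  rewrite (_ : E * (_ * _) * M = E * (4 ^+ m * M) * (eta / 4) ^+ m); last by ring.
  apply: ler_wpM2l; first by rewrite mulr_ge0// mulr_ge0// exprn_ge0.
  by apply: ler_wiXn2l => //; [exact: ltW|clear -eta1; lra].
Qed.

(** The arrival time is off by at most d, at a speed of at most 3/2; the speed is off by at most A,
    over a time of at most N + T. *)
Lemma leaf_pos_peak delta A d b s t : 0 <= delta -> r2 ^+ N * delta <= 4^-1 ->
  0 <= A <= 4^-1 -> leaf T b s -> `|t - node_time T delta s| <= d ->
  `|1 - t * speed b (amp delta b (size s).+1 + node_sign (b :: s) * A) - leaf_pos delta b s|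
    <= 3 / 2 * d + (N%:R + T) * A.
Proof.
move=> d0 P4 /andP[A0 A4] /andP[s0 _] ts; have sN := node_time_size_lt s0.
set a := amp _ _ _; set c := a + _.
have a4 : `|a| <= 4^-1 by exact: le_trans (amp_le b d0 sN) P4.
have sgA : `|node_sign (b :: s) * A| = A by rewrite normrM node_sign_norm mul1r ger0_norm.
have a2 : `|a| <= 2^-1 by apply: le_trans a4 _; lra.
have c2 : `|c| <= 2^-1.
  by apply: le_trans (ler_normD _ _) _; rewrite sgA; clear -a4 A4; lra.
have sd := speed_dist b a2 c2.
have cE : c - a = node_sign (b :: s) * A by rewrite /c addrC addKr.
rewrite cE sgA in sd.
have /andP[sc1 sc2] := speed_bounds b c2.
have qT : `|node_time T delta s| <= N%:R + T.
  have q0 := node_time0_le s.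
  have P2 : r2 ^+ N * delta <= 2^-1 by apply: le_trans P4 _; lra.
  have D := node_time_dist T d0 (ltnW sN) P2.
  have NP : N%:R * (2 * (r2 ^+ N * delta)) <= N%:R.
    by rewrite ler_piMr//; clear -P4; lra.
  have := ler_normD (node_time T delta s - node_time T 0 s) (node_time T 0 s).
  by rewrite subrK (gtr0_norm s0); clear -D NP q0; lra.
rewrite /leaf_pos -/a (_ : _ - _ = - ((t - node_time T delta s) * speed b c +
  node_time T delta s * (speed b c - speed b a))); last by ring.
rewrite normrN; apply: le_trans (ler_normD _ _) _; rewrite !normrM.
rewrite (@ger0_norm _ (speed b c)); last by rewrite (le_trans _ sc1)//; lra.
apply: lerD; last exact: ler_pM.
by rewrite [leRHS]mulrC; apply: ler_pM => //; rewrite (le_trans _ sc1)//; lra.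
Qed.

(** Speeds lie between 3/4 and 3/2. The lower bound 3/8 eta exceeds the radius eta / 4 of the bump,
    so the plateau lies outside it. *)
Lemma leaf_pos_plateau delta eta b s t : 0 <= delta -> r2 ^+ N * delta <= 4^-1 ->
  0 < eta -> leaf T b s ->
  node_time T delta s - eta <= t <= node_time T delta s - eta / 2 ->
  3 / 8 * eta <= 1 - t * speed b (amp delta b (size s).+1) - leaf_pos delta b s <= 3 / 2 * eta.
Proof.
move=> d0 P4 eta0 /andP[s0 _] /andP[t1 t2]; have sN := node_time_size_lt s0.
set c := amp _ _ _.
have c2 : `|c| <= 2^-1.
  by apply: le_trans (amp_le b d0 sN) _; apply: le_trans P4 _; lra.
have /andP[sc1 sc2] := speed_bounds b c2.
have -> : 1 - t * speed b c - leaf_pos delta b s = (node_time T delta s - t) * speed b c.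
  by rewrite /leaf_pos -/c; ring.
clear -eta0 t1 t2 sc1 sc2; move: (node_time _ _ _) (speed _ _) t1 t2 sc1 sc2 => q l t1 t2 l1 l2.
apply/andP; split.
  by apply: (@le_trans _ _ (eta / 2 * (3 / 4))); [|apply: ler_pM]; lra.
by rewrite [leRHS]mulrC; apply: ler_pM; lra.
Qed.

(* delta is the size of the base state, A and eta are the height and the width of
   the bumps; d absorbs the displacement of the characteristics by the bumps. *)
Record leaf_data (m : nat) (B E delta A eta d : R) (f : bool -> R -> R) : Prop := {
  delta_gt0 : 0 < delta;
  peak_eq : A = E * eta ^+ m;
  peak_ge0 : 0 <= A;
  peak_le : A <= eta / 8;
  eta_gt0 : 0 < eta;
  eta_le : eta <= 4^-1;
  amp_small : forall b l, (l <= N)%N -> `|amp delta b l| + A <= 2^-1;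
  node_time_ge : forall s, 0 < node_time T 0 s -> d <= node_time T delta s /\ eta <= node_time T delta s;
  peak_spread : N%:R * (2 * A) <= d;
  data_peak : forall b s t, leaf T b s -> `|t - node_time T delta s| <= d ->
    let c := amp delta b (size s).+1 + node_sign (b :: s) * A in
    0 <= 1 - t * speed b c <= 1 /\ f b (1 - t * speed b c) = c;
  data_flat : forall b s t, leaf T b s ->
    node_time T delta s - eta <= t <= node_time T delta s - eta / 2 ->
    let c := amp delta b (size s).+1 in
    0 <= 1 - t * speed b c <= 1 /\ f b (1 - t * speed b c) = c;
  data_Ck : forall b, Ck m (f b);
  data_flat0 : forall b, flat_at 0 (f b);
  data_flat1 : forall b, flat_at 1 (f b);
  data_bound : forall b j, (j <= m)%N -> forall x, `|(f b)^`(j)%classic x| <= E * B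
}.

(** As eta <= mu / 32, points within 3/2 eta of a perturbed position stay on a base plateau; as
    these positions are 4 eta apart, such points meet no bump of another leaf. *)
Lemma leaf_data_of_profiles m M B E eta delta mu h g :
  0 <= E -> 0 < eta -> eta <= mu / 32 -> 0 < mu <= 1 -> margin mu ->
  0 < delta -> r2 ^+ N * delta <= 4^-1 ->
  (3 * N%:R + T) * (r2 ^+ N * delta) <= mu / 64 -> delta * B <= E ->
  E * eta ^+ m * (64 * (4 * N%:R + T)) <= eta ->
  (forall b s s', leaf T b s -> leaf T b s' -> s <> s' ->
    4 * eta <= `|leaf_pos delta b s - leaf_pos delta b s'|) ->
  (forall b, base_spec m mu B b (h b)) -> (forall b, bump_spec m M E eta delta b (g b)) ->
  leaf_data m (1 + 4 ^+ m * M) E delta (E * eta ^+ m) eta (eta / 16)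
    (fun b x => delta * h b x + g b x).
Proof.
move=> E0 eta0 eta_mu /andP[mu0 mu1] [Hmu_t Hmu] d0 P4 Pmu dB AN sep hP gP.
have A0 : 0 <= E * eta ^+ m by rewrite mulr_ge0// exprn_ge0// ltW.
set A := E * eta ^+ m in A0 AN *.
have N2 : 2 <= N%:R :> R by rewrite ler_nat leq_addl.
have T0 : 0 < T by rewrite ltr_wpDl.
have AN1 : N%:R * A <= eta / 64 /\ (N%:R + T) * A <= eta / 64.
  have X : A * (4 * N%:R + T) <= eta / 64.
    by rewrite ler_pdivlMr// -mulrA [_ * 64]mulrC.
  by split; apply: le_trans X; rewrite mulrC ler_wpM2l//; clear -N2 T0; lra.
have [AN2 ANT] := AN1.
have A64 : A <= eta / 128.
  rewrite -(ler_pM2l (_ : 0 < 2 :> R))//; apply: (@le_trans _ _ (N%:R * A)).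
    by rewrite ler_wpM2r.
  by apply: le_trans AN2 _; clear; lra.
have near := leaf_pos_near (ltW d0) P4 Pmu.
have plateau b s x : leaf T b s -> `|x - leaf_pos delta b s| <= 3 / 2 * eta ->
    0 <= x <= 1 /\ h b x = amp 1 b (size s).+1.
  move=> ls xs; have [h1 h2 _] := Hmu _ _ ls; have d1 := near _ _ ls.
  have xs0 : `|x - leaf_pos 0 b s| <= mu / 8.
    have := ler_distD (leaf_pos delta b s) x (leaf_pos 0 b s).
    by clear -d1 xs eta_mu mu0; lra.
  have [_ H _ _] := hP b; split; last exact: H.
  by move: xs0; rewrite ler_norml => /andP[y1 y2]; clear -h1 h2 mu0 y1 y2; apply/andP; split; lra.
(* Positions at rest stay [mu] away from 0 and 1, so both profiles vanish within mu / 2 of the end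
   points. *)
have far_end b y : (forall s, leaf T b s -> mu / 2 <= `|y - leaf_pos 0 b s|) ->
    delta * h b y + g b y = 0.
  move=> H; have [_ _ h3 _] := hP b; have [_ _ g3 _] := gP b.
  rewrite (h3 y) ?(g3 y) ?mulr0 ?addr0// => s ls; have Hs := H s ls.
    have := near _ _ ls; have := ler_distD (leaf_pos delta b s) y (leaf_pos 0 b s).
    by clear -Hs eta_mu mu0; lra.
  by clear -Hs mu0; lra.
have ampN b l : (l <= N)%N -> `|amp delta b l| <= 4^-1.
  by move=> lN; apply: le_trans P4; exact: amp_le (ltW d0) lN.
have A4 : A <= 4^-1 by clear -A64 eta_mu mu1; lra.
split => //.
- by clear -A64 eta0; lra.
- by clear -eta_mu mu1; lra.
- by move=> b l /(ampN b) y; clear -A4 y; lra.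
- move=> s s0; have sN := node_time_size_lt s0; have q0 := Hmu_t _ s0.
  have P2 : r2 ^+ N * delta <= 2^-1 by apply: le_trans P4 _; lra.
  have := node_time_dist T (ltW d0) (ltnW sN) P2; rewrite ler_norml => /andP[D _].
  have NP : N%:R * (2 * (r2 ^+ N * delta)) <= mu / 64.
    apply: le_trans Pmu; rewrite mulrA ler_wpM2r//; last by clear -N2 T0; lra.
    by rewrite mulr_ge0 ?exprn_ge0 ?sqrtr_ge0// ltW.
  by clear -D NP q0 eta_mu mu0 eta0; split; lra.
- by rewrite mulrCA; clear -AN2 eta0; lra.
- move=> b s t ls ts c.
  (* With d = eta / 16 the displacement is at most 3/2 d + eta / 64 = 7/64 eta, below the radius eta
     / 8 on which the bump is constant. *)
  have xs := leaf_pos_peak (ltW d0) P4 (introT andP (conj A0 A4)) ls ts.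
  have {}xs : `|1 - t * speed b c - leaf_pos delta b s| <= eta / 8.
    by apply: le_trans xs _; clear -ANT eta0; lra.
  have xs' : `|1 - t * speed b c - leaf_pos delta b s| <= 3 / 2 * eta.
    by apply: le_trans xs _; clear -eta0; lra.
  have [x01 hx] := plateau b s _ ls xs'; have [_ gpeak _ _] := gP b.
  by split => //; rewrite hx (gpeak s)// -amp_scale.
- move=> b s t ls ts c.
  have /andP[x1 x2] := leaf_pos_plateau (ltW d0) P4 eta0 ls ts; rewrite -/c in x1 x2.
  have x0 : 0 <= 1 - t * speed b c - leaf_pos delta b s by clear -x1 eta0; lra.
  have xs : `|1 - t * speed b c - leaf_pos delta b s| <= 3 / 2 * eta by rewrite ger0_norm.
  have [x01 hx] := plateau b s _ ls xs; have [_ _ gfar _] := gP b.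
  split => //; rewrite hx gfar ?addr0 -?amp_scale// => s' ls'.
  have [<-|/eqP ne] := eqVneq s s'; first by rewrite ger0_norm//; clear -x1 eta0; lra.
  have := sep _ _ _ ls ls' ne.
  have := ler_distD (1 - t * speed b c) (leaf_pos delta b s) (leaf_pos delta b s').
  rewrite distrC in xs; clear -xs eta0; lra.
- move=> b; have [h1 _ _ _] := hP b; have [g1 _ _ _] := gP b.
  exact: CkD (CkM (Ck_cst _ _) h1) g1.
- move=> b; exists (mu / 2); first by rewrite divr_gt0.
  move=> y _; rewrite subr0 ltr_norml => /andP[y1 y2]; apply: far_end => s /Hmu[p1 _ _].
  by clear -y1 y2 p1; rewrite ler0_norm; lra.
- move=> b; exists (mu / 2); first by rewrite divr_gt0.
  move=> y _; rewrite ltr_norml => /andP[y1 y2]; apply: far_end => s /Hmu[_ p1 _].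
  by clear -y1 y2 p1; rewrite ger0_norm; lra.
move=> b j jm x; have [h1 _ _ h4] := hP b; have [g1 _ _ g4] := gP b.
rewrite (derive1n_lin delta h1 g1 jm) mulrDr mulr1.
apply: le_trans (ler_normD _ _) _; apply: lerD; last exact: g4.
rewrite normrM gtr0_norm//; apply: le_trans dB.
by rewrite ler_pM2l//; exact: h4.
Qed.

(** [E] may shrink with k, but the factor 1 + 4^m M between the bound on the data and [E] does not
    depend on k. *)
Lemma leaf_data_exist m (M E0 : R) : m <> 0%N -> interpolation_constant m M -> 0 < E0 ->
  exists2 E, 0 < E <= E0 &
    exists delta A eta d f, leaf_data m (1 + 4 ^+ m * M) E delta A eta d f.
Proof.
move=> m0 interp E00.
have T0 : 0 < T by rewrite ltr_wpDl.
have NT0 : 0 < 4 * N%:R + T by rewrite ltr_wpDl.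
have NT0' : 0 < 3 * N%:R + T by rewrite ltr_wpDl.
pose E := Num.min E0 (64 * (4 * N%:R + T))^-1.
have E_gt0 : 0 < E by rewrite lt_min E00 invr_gt0 mulr_gt0.
have E_small : E * (64 * (4 * N%:R + T)) <= 1.
  by rewrite -ler_pdivlMr ?mulr_gt0// mul1r ge_min lexx orbT.
have [mu /andP[mu0 mu1] Hmu] := base_margin.
have [B B0 [h hP]] := base_profile interp mu0 Hmu.
have P10 : 0 < r2 ^+ N by rewrite exprn_gt0// sqrtr_gt0.
(* [P] is the size of the base state at the deepest level. The three caps bound the amplitudes, the
   displacement of the positions and the norm of the base profile. *)
pose P := Num.min (4^-1) (Num.min (mu / 64 / (3 * N%:R + T)) (E / (B + 1) * r2 ^+ N)).
have B1 : 0 < B + 1 by rewrite ltr_wpDl.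
have P0 : 0 < P.
  rewrite !lt_min; apply/and3P; split; first by rewrite invr_gt0.
    by rewrite !divr_gt0.
  by apply: mulr_gt0 => //; exact: divr_gt0.
pose delta := P / r2 ^+ N.
have delta0 : 0 < delta by rewrite divr_gt0.
have PE : r2 ^+ N * delta = P by rewrite mulrC divfK// gt_eqF.
have P4 : r2 ^+ N * delta <= 4^-1 by rewrite PE ge_min lexx.
have Pmu : (3 * N%:R + T) * (r2 ^+ N * delta) <= mu / 64.
  by rewrite PE mulrC -ler_pdivlMr// !ge_min lexx orbT.
have dB : delta * B <= E.
  apply: (@le_trans _ _ (delta * (B + 1))); first by rewrite ler_pM2l// lerDl.
  by rewrite -ler_pdivlMr// ler_pdivrMr// !ge_min lexx !orbT.
have [kap /andP[kap0 kapmu] Hkap] := leaf_pos_separated delta0 P4 Pmu mu0 Hmu.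
pose eta := kap / 4; have eta0 : 0 < eta by rewrite divr_gt0.
have eta32 : eta <= mu / 32 by rewrite /eta; clear -kapmu; lra.
have eta1 : eta <= 1 by clear -eta32 mu1; lra.
have sep b s s' : leaf T b s -> leaf T b s' -> s <> s' ->
    4 * eta <= `|leaf_pos delta b s - leaf_pos delta b s'|.
  by rewrite /eta mulrC divfK//; exact: Hkap.
have [g gP] := bump_profile interp (ltW E_gt0) (introT andP (conj eta0 eta1)) sep.
exists E; first by rewrite E_gt0 ge_min lexx.
exists delta, (E * eta ^+ m), eta, (eta / 16), (fun b x => delta * h b x + g b x).
apply: (@leaf_data_of_profiles _ _ B _ _ _ mu) => //; [exact: ltW|by rewrite mu0|].
(* Here m >= 1 enters: eta^m <= eta, so the smallness of [E], fixed before [eta], is enough. *)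
rewrite mulrAC; apply: (@le_trans _ _ (eta ^+ m)).
  by rewrite ler_piMl// exprn_ge0// ltW.
rewrite -[leRHS]expr1; apply: ler_wiXn2l; [exact: ltW|exact: eta1|].
by rewrite lt0n; exact/eqP.
Qed.

End FixK.
End Design.

(** * Instability *)

Section Instability.
Context {R : realType} {p : nat}.
Local Notation V := 'cV[R]_(p.+2).
Local Notation G := (mulmx (Kmx 2^-1) : V -> V).

(** A characteristic starting at x takes the time (1 - x) / speed to reach x = 1; this gives the
    traces the delay relations that drive the tree. *)
Lemma solution_traces m k (B E delta A eta d : R) (f : bool -> R -> R) (u : R -> R -> V) (L : R) :
  m <> 0%N -> leaf_data k m B E delta A eta d f ->
  is_solution Fsys G (toC m (vec2 f)) u ->
  (forall t x, Rplus t -> I01 x -> `|u t x| <= 2^-1) ->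
  (forall t x, 0 < t -> I01 x -> `|dx u t x| <= L) ->
  u (k%:R + 2^-1) 0 (active false) 0 = delta + A /\
  forall t, k%:R + 2^-1 - eta <= t <= k%:R + 2^-1 - eta / 2 -> u t 0 (active false) 0 = delta.
Proof.
move=> m0 D sol u2 uL.
have u1 t x : Rplus t -> I01 x -> `|u t x| <= 1.
  by move=> Pt Ix; apply: le_trans (u2 t x Pt Ix) _; lra.
have char := solution_constant_along m0 sol u1 uL.
have [_ _ bc ic] := sol.
have I0 : (I01 : set R) 0 by rewrite /I01/= in_itv/= lexx ler01.
have P0 (t : R) : 0 <= t -> Rplus t by move=> ?; rewrite /Rplus/= in_itv/= andbT.
have vf t : 0 <= t -> u t 0 (active false) 0 = 2^-1 * (u t 1 (active false) 0 + u t 1 (active true) 0).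
  by move=> /P0 t0; rewrite bc// Kmx_mul.
have vt t : 0 <= t -> u t 0 (active true) 0 = 2^-1 * (u t 1 (active false) 0 - u t 1 (active true) 0).
  by move=> /P0 t0; rewrite bc// Kmx_mul.
have wv b t : 0 <= t -> `|u t 0 (active b) 0| <= 2^-1 ->
    u (t + (speed b (u t 0 (active b) 0))^-1) 1 (active b) 0 = u t 0 (active b) 0.
  move=> t0 c2; have /andP[s1 _] := speed_bounds b c2.
  set r := speed b _ in s1 *; have r0 : 0 < r by apply: lt_le_trans s1; lra.
  have := @char b t 0 r^-1 (P0 _ t0) I0; rewrite /= -/r add0r mulfV ?gt_eqF// lexx.
  by rewrite invr_ge0 ltW//; apply.
have wf b x : 0 <= x <= 1 -> `|f b x| <= 2^-1 ->
    u ((1 - x) / speed b (f b x)) 1 (active b) 0 = f b x.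
  move=> x01 c2; have /andP[s1 _] := speed_bounds b c2.
  have Ix : I01 x by rewrite /I01/= in_itv.
  have E0 : u 0 x (active b) 0 = f b x.
    by rewrite ic//; have [-> //] := Ck_initial_data (p := p) (data_Ck D).
  have r0 : 0 < speed b (f b x) by apply: lt_le_trans s1; lra.
  have := @char b 0 x ((1 - x) / speed b (f b x)) (P0 _ (lexx 0)) Ix.
  rewrite /= E0 add0r [_ * (_ / _)]mulrC divfK ?gt_eqF// [x + _]addrC subrK lexx; apply => //.
  by rewrite divr_ge0 ?(ltW r0)// subr_ge0; case/andP: x01.
have A0 := peak_ge0 D.
split.
  exact: (@root_peak R k delta A eta d f (fun b t => u t 0 (active b) 0)
   (fun b t => u t 1 (active b) 0) A0 (amp_small D) vf vt wv wf
   (node_time_ge D) (peak_spread D) (data_peak D) (data_flat D)).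
exact: (@root_flat R k delta A eta d f (fun b t => u t 0 (active b) 0)
   (fun b t => u t 1 (active b) 0) A0 (amp_small D) vf vt wv wf
   (node_time_ge D) (peak_spread D) (data_peak D) (data_flat D)).
Qed.

Lemma archimedean_expR (a b : R) : 0 < a -> exists k : nat, b * expR (- a * k.+1%:R) < 1.
Proof.
move=> a0; exists (Num.bound (`|b| / a)).
have := archi_boundP (divr_ge0 (normr_ge0 b) (ltW a0)); set k := Num.bound _.
rewrite ltr_pdivrMr// => bk.
rewrite mulNr expRN -ltr_pdivlMr ?invr_gt0 ?expR_gt0// mul1r invrK.
apply: lt_le_trans (expR_ge1Dx _).
have := ler_norm b; rewrite -natr1; move: bk; rewrite mulrC => bk bb.
by rewrite mulrDr mulr1; lra.
Qed.

Lemma not_exponentially_stable m : m <> 0%N -> ~ exponentially_stable Fsys G m.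
Proof.
move=> m0 [eps [nu [C [eps0 nu0 C0 H]]]].
have [M interp] := @smooth_interpolation R m.
pose B := 1 + 4 ^+ m * M.
have B0 : 0 < B by rewrite ltr_wpDr// mulr_ge0 ?exprn_ge0//; case: interp.
(* [B] depends on m only, so k can be chosen now. *)
have [k kP] := archimedean_expR (C * B) nu0.
(* The first cap makes the data admissible; the second keeps the solution below 1/2, where the
   speeds are between 3/4 and 3/2. *)
pose E0 := Num.min (eps / B) (2^-1 / (B * (C + 1))).
have C1 : 0 < C + 1 by rewrite ltr_wpDr// ltW.
have E00 : 0 < E0 by rewrite lt_min !divr_gt0// mulr_gt0.
have [E /andP[E_gt0 EE0] [delta [A [eta [d [f D]]]]]] := leaf_data_exist k m0 interp E00.
have EBeps : E * B <= eps.
  by rewrite -ler_pdivlMr//; apply: le_trans EE0 _; rewrite ge_min lexx.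
have EBC : (E * B) * (C + 1) <= 2^-1.
  rewrite -mulrA -ler_pdivlMr ?mulr_gt0//; apply: le_trans EE0 _.
  by rewrite ge_min lexx orbT.
have EB0 : 0 < E * B by rewrite mulr_gt0.
have EB2 : E * B <= 2^-1 by apply: le_trans EBC; rewrite ler_peMr ?(ltW EB0)// lerDr ltW.
have EBC2 : C * (E * B) <= 2^-1.
  by apply: le_trans EBC; rewrite mulrC ler_pM2l// lerDl.
have [u0E u0flat u0B] := Ck_initial_data (p := p) (data_Ck D).
pose u0 : Cspace m V := toC m (vec2 f).
have u0_le : `|u0| <= E * B.
  by apply: u0B; [exact: ltW|exact: data_bound D].
have u0_comp : compatible Fsys G u0.
  apply: compatible_flat; first exact: mulmx0.
    exact/u0flat/(data_flat0 D).
  exact/u0flat/(data_flat1 D).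
have [u [sol _ decay]] := H u0 u0_comp (le_trans u0_le EBeps).
have [uC _ _ ic] := sol.
have I0 : (I01 : set R) 0 by rewrite /I01/= in_itv/= lexx ler01.
have P0 (t : R) : 0 <= t -> Rplus t by move=> ?; rewrite /Rplus/= in_itv/= andbT.
have slice t := class_C_strip_slice (t := t) ^~ uC.
have decay2 t : 0 < t -> Cnorm m (u t) <= 2^-1.
  move=> t0; apply: le_trans (decay t t0) _; apply: le_trans EBC2.
  rewrite -mulrA ler_pM2l//; apply: le_trans u0_le; rewrite ler_piMl//.
  by rewrite expR_le1 mulNr oppr_le0 mulr_ge0// ltW.
have u2 t x : Rplus t -> I01 x -> `|u t x| <= 2^-1.
  move=> Pt Ix; have : 0 <= t by move: Pt; rewrite /Rplus/= in_itv/= andbT.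
  rewrite le_eqVlt => /predU1P[t0|t0].
    rewrite -t0 ic//; apply: le_trans EB2; apply: le_trans u0_le.
    exact: (Cnorm_ge (Cfun_class u0) (leq0n m) Ix).
  by apply: le_trans (decay2 t t0); exact: (Cnorm_ge (slice t Pt) (leq0n m) Ix).
have uL t x : 0 < t -> I01 x -> `|dx u t x| <= 2^-1.
  move=> t0 Ix; apply: le_trans (decay2 t t0).
  have m1 : (1 <= m)%N by rewrite lt0n; exact/eqP.
  exact: (Cnorm_ge (slice t (P0 _ (ltW t0))) m1 Ix).
have [peak flat] := solution_traces m0 D sol u2 uL.
have u1 t x : Rplus t -> I01 x -> `|u t x| <= 1.
  by move=> Pt Ix; apply: le_trans (u2 t x Pt Ix) _; clear; lra.
have char := @solution_constant_along _ _ _ _ _ _ _ m0 sol u1 uL false.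
have T0 : 0 <= k%:R + 2^-1 :> R by rewrite addr_ge0.
have peak2 : `|delta + A| <= 2^-1.
  by rewrite -peak; apply: le_trans (normcV_coord _ _) _; exact: u2 (P0 _ T0) I0.
have delta2 : `|delta| <= 2^-1.
  move: peak2; have := delta_gt0 D; have := peak_ge0 D; clear => A0 d0.
  by rewrite !ger0_norm ?addr_ge0 ?(ltW d0)//; lra.
have /andP[rp1 rp2] : 3/4 <= speed false (delta + A) <= 1.
  have /andP[-> _] := speed_bounds false peak2.
  by rewrite /speed gerBl sqr_ge0.
have /andP[rd1 rd2] : 3/4 <= speed false delta <= 1.
  have /andP[-> _] := speed_bounds false delta2.
  by rewrite /speed gerBl sqr_ge0.
have rdist : `|speed false (delta + A) - speed false delta| <= A.
  apply: le_trans (speed_dist false delta2 peak2) _.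
  by rewrite addrC addKr ger0_norm// (peak_ge0 D).
set rp := speed false (delta + A) in rp1 rp2 rdist.
set rd := speed false delta in rd1 rd2 rdist.
(* Half a unit of time after T, the time profile at x = 0 has become a spatial profile inside (0,
   1). *)
have T1 : k%:R + 2^-1 + 2^-1 = k.+1%:R :> R by rewrite -natr1; field.
have eta0 := eta_gt0 D; have eta4 := eta_le D; have A8 := peak_le D.
have upeak : u k.+1%:R (rp * 2^-1) (active false) 0 = delta + A.
  have := @char (k%:R + 2^-1) 0 2^-1 (P0 _ T0) I0; lazy zeta.
  rewrite peak -/rp add0r T1; apply; first by clear -rp1; lra.
    by rewrite invr_ge0.
  by clear -rp2; lra.
have uflat x : rd * (2^-1 + eta / 2) < x < rd * (2^-1 + eta) ->
    u k.+1%:R x (active false) 0 = delta.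
  move=> /andP[x1 x2]; pose s := x / rd.
  have rd0 : 0 < rd by clear -rd1; lra.
  have s1 : 2^-1 + eta / 2 < s by rewrite ltr_pdivlMr// mulrC.
  have s2 : s < 2^-1 + eta by rewrite ltr_pdivrMr// mulrC.
  have vt := flat (k.+1%:R - s) ltac:(by rewrite -T1; clear -s1 s2; apply/andP; split; lra).
  have t0 : 0 <= k.+1%:R - s by rewrite -T1 subr_ge0; have := ler0n R k; clear -s2 eta4; lra.
  have := @char (k.+1%:R - s) 0 s (P0 _ t0) I0; lazy zeta.
  rewrite vt -/rd add0r subrK /s [rd * _]mulrC divfK ?gt_eqF//; apply => //.
    by rewrite -/s; clear -s1 eta0; lra.
  have : rd * (2^-1 + eta) <= 1 * (2^-1 + eta) by rewrite ler_wpM2r//; clear -eta0; lra.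
  by clear -x2 eta4; lra.
(* The middle of the plateau; its distance to the peak is at most A / 2 + 3/4 eta, hence at most eta
   since A <= eta / 8. *)
pose x' := rd * (2^-1 + 3 / 4 * eta).
have rd0 : 0 < rd by clear -rd1; lra.
have k0 : 0 < k.+1%:R :> R by [].
pose M' := C * expR (- nu * k.+1%:R) * `|u0|.
have M'lt : M' < E.
  have : M' <= C * expR (- nu * k.+1%:R) * (E * B).
    by rewrite ler_wpM2l// mulr_ge0 ?expR_ge0// ltW.
  move/le_lt_trans; apply.
  rewrite (_ : _ * (E * B) = E * (C * B * expR (- nu * k.+1%:R))); last by ring.
  by rewrite -[ltRHS]mulr1 ltr_pM2l.
have : `|u k.+1%:R (rp * 2^-1) (active false) 0 - delta| <= M' * eta ^+ m.
  apply: (@slice_gap R _ m _ _ M' eta delta _ _ x' _ m0 (slice _ (P0 _ (ltW k0))) _ _ _ _ uflat).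
  - move=> x Ix; apply: le_trans (decay _ k0).
    exact: (Cnorm_ge (slice _ (P0 _ (ltW k0))) (leqnn m) Ix).
  - by rewrite mulr_ge0 ?(ltW rd0)//; clear -eta0; lra.
  - apply: (@le_trans _ _ (1 * (2^-1 + eta))); first by rewrite ler_wpM2r//; clear -eta0; lra.
    by clear -eta4; lra.
  - by rewrite /x' !ltr_pM2l// !ltrD2l; clear -eta0; apply/andP; split; lra.
  - by clear -rp1 rp2; apply/andP; split; lra.
  - rewrite /x' (_ : _ - _ = 2^-1 * (rp - rd) - rd * (3 / 4 * eta)); last by field.
    apply: le_trans (ler_normB _ _) _.
    have e34 : 0 <= 3 / 4 * eta by clear -eta0; lra.
    rewrite (ger0_norm (mulr_ge0 (ltW rd0) e34)).
    rewrite normrM (@ger0_norm _ 2^-1) ?invr_ge0//.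
    have : rd * (3 / 4 * eta) <= 1 * (3 / 4 * eta) by rewrite ler_wpM2r.
    by clear -rdist A8 eta0; lra.
(* The gap is A = E eta^m, so E <= M', against the decay. *)
rewrite upeak addrC addKr (ger0_norm (peak_ge0 D)) (peak_eq D) ler_pM2r ?exprn_gt0//.
by rewrite leNgt M'lt.
Qed.

End Instability.

Unset Implicit Arguments.

Theorem theorem2 (R : realType) (m n : nat) (hm : m <> 0%N) (hn : (2 <= n)%N)
    (tau : R) (htau : 0 < tau) :
  exists (F : 'cV[R]_n -> 'M[R]_n) (G : {linear 'cV[R]_n -> 'cV[R]_n}),
    smooth F /\
    (forall u : 'cV[R]_n, is_diag_mx (F u)) /\
    distinct_positive_eigenvalues (F 0) /\
    hat_rho +oo%E (jacobian_mx G 0) < 1 + tau /\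
    hat_rho0 (jacobian_mx G 0) = hat_rho 2%:E (jacobian_mx G 0) /\
    hat_rho 2%:E (jacobian_mx G 0) < 1 /\
    ~ exponentially_stable F G m.
Proof.
case: n hn => [|[|p]]// _.
exists Fsys, (mulmx (Kmx 2^-1) : {linear 'cV[R]_p.+2 -> 'cV[R]_p.+2}).
rewrite jacobian_mulmx hat_rho0_K hat_rho2_K.
split; first exact: smooth_Fsys.
split; first exact: is_diag_Fsys.
split; first exact: eigenvalues_Fsys0.
split; first by apply: le_lt_trans hat_rho_K_oo _; rewrite ltrDl.
split=> //; split; first by rewrite -(@hat_rho2_K R p); exact: hat_rho2_K_lt1.
exact: not_exponentially_stable.
Qed.
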